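(* Let $\mathfrak g$ be a finite-dimensional complex simple Lie algebra and let $\mathfrak L(\mathfrak g)$ be the associated affine-Virasoro Lie algebra. Then every biderivation of $\mathfrak L(\mathfrak g)$ is inner; that is, for every biderivation $F$ of $\mathfrak L(\mathfrak g)$ there exists $\lambda\in\mathbb C$ such that $F(x,y)=\lambda[x,y]$ for all $x,y\in\mathfrak L(\mathfrak g)$.
   Context: All vector spaces, algebras and tensor products are over $\mathbb C$. Let $(\cdot,\cdot)$ be the Killing form of $\mathfrak g$. The affine-Virasoro Lie algebra is the vector space $\mathfrak L(\mathfrak g)=(\mathfrak g\otimes\mathbb C[t^{\pm1}])\oplus\mathbb C K_1\oplus\mathbb C K_2\oplus\bigoplus_{m\in\mathbb Z}\mathbb C d_m$ with brackets, for $x,y\in\mathfrak g$, $m,n\in\mathbb Z$: $[x\otimes t^m,y\otimes t^n]=[x,y]\otimes t^{m+n}+m(x,y)\delta_{m+n,0}K_1$; $[\mathfrak L(\mathfrak g),K_1]=[\mathfrak L(\mathfrak g),K_2]=0$; $[d_m,x\otimes t^n]=n\,x\otimes t^{m+n}$; $[d_m,d_n]=(n-m)d_{m+n}+\delta_{m+n,0}\frac{m^3-m}{12}K_2$. A biderivation of a Lie algebra $L$ is a bilinear map $F:L\times L\to L$ such that for all $x,y,z\in L$: $F([x,y],z)=[x,F(y,z)]-[y,F(x,z)]$ and $F(x,[y,z])=[y,F(x,z)]-[z,F(x,y)]$. A biderivation is inner if it has the form $F_\lambda(x,y)=\lambda[x,y]$ for some $\lambda\in\mathbb C$. *)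

(* Defs.v *)
From HB Require Import structures.
From mathcomp Require Import all_boot all_order all_algebra sesquilinear.
From mathcomp Require Import finmap.
From mathcomp.multinomials Require Import monalg.
From mathcomp Require Import ring.

Set Implicit Arguments.
Unset Strict Implicit.
Unset Printing Implicit Defensive.

Import Order.TTheory GRing.Theory Num.Theory passmx.
Local Open Scope ring_scope.

HB.mixin Record isLieAlgebra (K : comNzRingType) L of GRing.Lmodule K L := {
  lie : L -> L -> L;
  lie_bilinear : bilinear_for *:%R *:%R lie;
  liexx : forall x, lie x x = 0;
  lie_jacobi : forall x y z,
    lie x (lie y z) + lie y (lie z x) + lie z (lie x y) = 0
}.

#[short(type="lieAlgType")]
HB.structure Definition LieAlgebra (K : comNzRingType) :=
  {L of isLieAlgebra K L & GRing.Lmodule K L}.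

#[short(type="finLieAlgType")]
HB.structure Definition FinLieAlgebra (K : comNzRingType) :=
  {L of isLieAlgebra K L & Vector K L}.

Section LieTheory.
Variables (K : comNzRingType) (L : lieAlgType K).

HB.instance Definition _ := bilinear_isBilinear.Build K L L L *:%R *:%R
  (@lie K L) lie_bilinear.
HB.instance Definition _ (x : L) :=
  GRing.isLinear.Build K L L *:%R (@lie K L x) (lie_bilinear.2 x).

Lemma lieC (x y : L) : lie x y = - lie y x.
Proof.
have := liexx (x + y).
rewrite (linearDl (@lie K L : {bilinear _ -> _ -> _})) !linearD/= !liexx.
by rewrite add0r addr0 => /eqP; rewrite addr_eq0 => /eqP.
Qed.

End LieTheory.

Section SimpleKilling.
Variables (K : fieldType) (g : finLieAlgType K).

Definition lie_ideal (I : {vspace g}) : Prop :=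
  forall x y : g, y \in I -> lie x y \in I.

Definition lie_simple : Prop :=
  (exists x y : g, lie x y <> 0) /\
  (forall I : {vspace g}, lie_ideal I -> I = 0%VS \/ I = fullv).

Definition ad (x : g) : 'End(g) := linfun (lie x).

Definition lfun_trace (f : 'End(g)) : K :=
  \tr (mxof (vbasis {:g}) (vbasis {:g}) f).

Definition killing (x y : g) : K := lfun_trace (ad x \o ad y)%VF.

Lemma adE (x y : g) : ad x y = lie x y.
Proof. exact: lfunE. Qed.

Lemma ad_linear : linear ad.
Proof.
move=> a x y; apply/lfunP => z.
by rewrite add_lfunE scale_lfunE !adE (lie_bilinear.1 z).
Qed.

Lemma lie_lie (x y z : g) : lie (lie x y) z = lie x (lie y z) - lie y (lie x z).
Proof.
have /eqP := lie_jacobi x y z; rewrite [lie z (lie x y)]lieC subr_eq0 => /eqP <-.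
by rewrite [lie z x]lieC linearN.
Qed.

Lemma ad_lie (x y : g) :
  ad (lie x y) = (ad x \o ad y)%VF - (ad y \o ad x)%VF.
Proof.
apply/lfunP => z; rewrite add_lfunE opp_lfunE !comp_lfunE !adE.
exact: lie_lie.
Qed.

Let e := vbasis {:g}.
Let A (x : g) := mxof e e (ad x).

Lemma killingE x y : killing x y = \tr (A y *m A x).
Proof.
by rewrite /killing /lfun_trace (mxof_comp _ _ (vbasisP _)).
Qed.

Lemma killingC x y : killing x y = killing y x.
Proof. by rewrite !killingE mxtrace_mulC. Qed.

Lemma killing_linear y : linear (killing^~ y : g -> K^o).
Proof.
move=> a x z; rewrite !killingE /A ad_linear linearP/=.
by rewrite linearD/= linearD/= -scalemxAr linearZ.
Qed.

Lemma killing_lie x y z : killing (lie x y) z = killing x (lie y z).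
Proof.
have Alie u v : A (lie u v) = A v *m A u - A u *m A v.
  by rewrite /A ad_lie linearB/= !(mxof_comp _ _ (vbasisP _)).
rewrite !killingE !Alie; move: (A x) (A y) (A z) => X Y Z.
rewrite mulmxBr mulmxBl ![\tr (_ - _)]linearB/= !mulmxA; congr (_ - _).
by rewrite mxtrace_mulC mulmxA.
Qed.

End SimpleKilling.

Section Laurent.
Variables (K : nzRingType) (V : lmodType K).

(* V ⊗ K[t, t^-1] as the finitely supported functions int -> V:
   << v *g m >> stands for v ⊗ t^m and f@_m is the coefficient of t^m. *)
Definition laurent := {malg V[int]}.
HB.instance Definition _ := GRing.Zmodule.on laurent.

Definition laurent_scale (c : K) (f : laurent) : laurent :=
  \sum_(m <- msupp f) << c *: f@_m *g m >>.

Lemma laurent_scaleE c f m : (laurent_scale c f)@_m = c *: f@_m.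
Proof.
rewrite {2}[f]monalgE !raddf_sum.
by apply: eq_bigr => k _; rewrite /= !mcoeffU scalerMnr.
Qed.

Fact laurent_scaleA a b f :
  laurent_scale a (laurent_scale b f) = laurent_scale (a * b) f.
Proof. by apply/malgP => m; rewrite !laurent_scaleE scalerA. Qed.
Fact laurent_scale1 : left_id 1 laurent_scale.
Proof. by move=> f; apply/malgP => m; rewrite laurent_scaleE scale1r. Qed.
Fact laurent_scaleDr : right_distributive laurent_scale +%R.
Proof.
by move=> c f h; apply/malgP => m; rewrite !(laurent_scaleE, mcoeffD) scalerDr.
Qed.
Fact laurent_scaleDl f : {morph laurent_scale^~ f : a b / a + b}.
Proof.
by move=> a b; apply/malgP => m; rewrite !(laurent_scaleE, mcoeffD) scalerDl.
Qed.

HB.instance Definition _ := GRing.Zmodule_isLmodule.Build K laurent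
  laurent_scaleA laurent_scale1 laurent_scaleDr laurent_scaleDl.

Lemma laurentZE (c : K) (f : laurent) m : (c *: f)@_m = c *: f@_m.
Proof. exact: laurent_scaleE. Qed.

Lemma laurentZU (c : K) (v : V) m :
  c *: (<< v *g m >> : laurent) = << c *: v *g m >>.
Proof. by apply/malgP => k; rewrite laurentZE !mcoeffU scalerMnr. Qed.

End Laurent.

Section Graded.
Variables (K : nzRingType) (U V W : lmodType K).

(* The bilinear extension of (u t^m, v t^n) |-> B m n u v t^(m + n). *)
Definition gmul (B : int -> int -> U -> V -> W)
    (f : {malg U[int]}) (h : {malg V[int]}) : {malg W[int]} :=
  \sum_(m <- msupp f) \sum_(n <- msupp h) << B m n f@_m h@_n *g m + n >>.

(* The bilinear extension of (u t^m, v t^n) |-> delta_(m + n, 0) B m u v. *)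
Definition gpair (B : int -> U -> V -> W)
    (f : {malg U[int]}) (h : {malg V[int]}) : W :=
  \sum_(m <- msupp f) B m f@_m h@_(- m).

Section Theory.
Variables (B : int -> int -> U -> V -> W) (b : int -> U -> V -> W).
Hypothesis Bl : forall m n v, linear (B m n ^~ v).
Hypothesis Br : forall m n u, linear (B m n u).
Hypothesis bl : forall m v, linear (b m ^~ v).
Hypothesis br : forall m u, linear (b m u).

Let B0l m n v : B m n 0 v = 0.
Proof. by have := Bl m n v (-1) 0 0; rewrite scaler0 addr0 scaleN1r addNr. Qed.
Let B0r m n u : B m n u 0 = 0.
Proof. by have := Br m n u (-1) 0 0; rewrite scaler0 addr0 scaleN1r addNr. Qed.
Let b0l m v : b m 0 v = 0.
Proof. by have := bl m v (-1) 0 0; rewrite scaler0 addr0 scaleN1r addNr. Qed.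
Let b0r m u : b m u 0 = 0.
Proof. by have := br m u (-1) 0 0; rewrite scaler0 addr0 scaleN1r addNr. Qed.

Lemma gmulw (d1 d2 : {fset int}) f h :
    (msupp f `<=` d1)%fset -> (msupp h `<=` d2)%fset ->
  gmul B f h = \sum_(m <- d1) \sum_(n <- d2) << B m n f@_m h@_n *g m + n >>.
Proof.
move=> s1 s2; rewrite /gmul (big_fset_incl _ s1)/=; last first.
  by move=> m _ /mcoeff_outdom ->; rewrite big1// => n _; rewrite B0l monalgU0.
apply: eq_bigr => m _; rewrite (big_fset_incl _ s2)//=.
by move=> n _ /mcoeff_outdom ->; rewrite B0r monalgU0.
Qed.

Lemma gpairw (d : {fset int}) f h : (msupp f `<=` d)%fset ->
  gpair b f h = \sum_(m <- d) b m f@_m h@_(- m).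
Proof.
move=> s; rewrite /gpair (big_fset_incl _ s)//=.
by move=> m _ /mcoeff_outdom ->; rewrite b0l.
Qed.

Lemma gmulPl a f f1 f2 h k : (forall m, f@_m = a *: f1@_m + f2@_m) ->
  (gmul B f h)@_k = a *: (gmul B f1 h)@_k + (gmul B f2 h)@_k.
Proof.
move=> fE; pose d := (msupp f `|` (msupp f1 `|` msupp f2))%fset.
have s0 : (msupp f `<=` d)%fset by exact: fsubsetUl.
have s1 : (msupp f1 `<=` d)%fset by rewrite fsubsetU// fsubsetUl orbT.
have s2 : (msupp f2 `<=` d)%fset by rewrite fsubsetU// fsubsetUr orbT.
rewrite (gmulw s0 (fsubset_refl _)) (gmulw s1 (fsubset_refl _)).
rewrite (gmulw s2 (fsubset_refl _)) !raddf_sum/= -big_split/=.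
apply: eq_bigr => m _; rewrite !raddf_sum/= -big_split/=.
apply: eq_bigr => n _; rewrite !mcoeffU fE Bl.
by case: eqP; rewrite ?mulr1n ?mulr0n ?scaler0 ?addr0.
Qed.

Lemma gmulPr a f h h1 h2 k : (forall m, h@_m = a *: h1@_m + h2@_m) ->
  (gmul B f h)@_k = a *: (gmul B f h1)@_k + (gmul B f h2)@_k.
Proof.
move=> hE; pose d := (msupp h `|` (msupp h1 `|` msupp h2))%fset.
have s0 : (msupp h `<=` d)%fset by exact: fsubsetUl.
have s1 : (msupp h1 `<=` d)%fset by rewrite fsubsetU// fsubsetUl orbT.
have s2 : (msupp h2 `<=` d)%fset by rewrite fsubsetU// fsubsetUr orbT.
rewrite (gmulw (fsubset_refl _) s0) (gmulw (fsubset_refl _) s1).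
rewrite (gmulw (fsubset_refl _) s2) !raddf_sum/= -big_split/=.
apply: eq_bigr => m _; rewrite !raddf_sum/= -big_split/=.
apply: eq_bigr => n _; rewrite !mcoeffU hE Br.
by case: eqP; rewrite ?mulr1n ?mulr0n ?scaler0 ?addr0.
Qed.

Lemma gpairPl a f f1 f2 h : (forall m, f@_m = a *: f1@_m + f2@_m) ->
  gpair b f h = a *: gpair b f1 h + gpair b f2 h.
Proof.
move=> fE; pose d := (msupp f `|` (msupp f1 `|` msupp f2))%fset.
have s0 : (msupp f `<=` d)%fset by exact: fsubsetUl.
have s1 : (msupp f1 `<=` d)%fset by rewrite fsubsetU// fsubsetUl orbT.
have s2 : (msupp f2 `<=` d)%fset by rewrite fsubsetU// fsubsetUr orbT.
rewrite (gpairw _ s0) (gpairw _ s1) (gpairw _ s2) scaler_sumr -big_split/=.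
by apply: eq_bigr => m _; rewrite fE bl.
Qed.

Lemma gpairPr a f h h1 h2 : (forall m, h@_m = a *: h1@_m + h2@_m) ->
  gpair b f h = a *: gpair b f h1 + gpair b f h2.
Proof.
move=> hE; rewrite /gpair scaler_sumr -big_split/=.
by apply: eq_bigr => m _; rewrite hE br.
Qed.

Lemma gmul0l h : gmul B 0 h = 0.
Proof. by rewrite /gmul msupp0 big_seq_fset0. Qed.

Lemma gmul0r f : gmul B f 0 = 0.
Proof. by rewrite /gmul big1// => m _; rewrite msupp0 big_seq_fset0. Qed.

Lemma gmulUU m n x y :
  gmul B << x *g m >> << y *g n >> = << B m n x y *g m + n >>.
Proof.
rewrite (gmulw msuppU_le msuppU_le) !big_seq_fset1.
by rewrite !mcoeffUU.
Qed.

Lemma gpair0l h : gpair b 0 h = 0.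
Proof. by rewrite /gpair msupp0 big_seq_fset0. Qed.

Lemma gpair0r f : gpair b f 0 = 0.
Proof. by rewrite /gpair big1// => m _; rewrite mcoeff0. Qed.

Lemma gpairUU m n x y :
  gpair b << x *g m >> << y *g n >> = b m x y *+ (m + n == 0).
Proof.
rewrite (gpairw _ msuppU_le) big_seq_fset1 mcoeffUU mcoeffU.
rewrite [m + n]addrC addr_eq0.
by case: eqP; rewrite ?mulr1n ?mulr0n.
Qed.

End Theory.
End Graded.

(* A space generated by the affine-Virasoro relations is a Lie algebra. *)
Section Presented.
Variables (K : numFieldType) (g : lieAlgType K) (kap : g -> g -> K).
Variables (V : lmodType K) (br : V -> V -> V).
Variables (X : g -> int -> V) (D : int -> V) (K1 K2 : V).
Hypothesis brPl : forall w a u v, br (a *: u + v) w = a *: br u w + br v w.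
Hypothesis brPr : forall w a u v, br w (a *: u + v) = a *: br w u + br w v.
Hypothesis XX : forall x m y n, br (X x m) (X y n) =
  X (lie x y) (m + n) + (m%:~R * kap x y *+ (m + n == 0)) *: K1.
Hypothesis DX : forall m x n, br (D m) (X x n) = n%:~R *: X x (m + n).
Hypothesis XDr : forall x m n, br (X x m) (D n) = - (m%:~R *: X x (n + m)).
Hypothesis DD : forall m n, br (D m) (D n) = (n - m)%:~R *: D (m + n)
    + ((m ^+ 3 - m)%:~R / 12 *+ (m + n == 0)) *: K2.
Hypothesis br1l : forall v, br K1 v = 0.
Hypothesis br2l : forall v, br K2 v = 0.
Hypothesis br1r : forall v, br v K1 = 0.
Hypothesis br2r : forall v, br v K2 = 0.
Hypothesis XD : forall x y m, X x m + X y m = X (x + y) m.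
Hypothesis kapC : forall x y, kap x y = kap y x.
Hypothesis kap_lie : forall x y z, kap (lie x y) z = kap x (lie y z).
Hypothesis Vind : forall P : V -> Prop,
  (forall a u v, P u -> P v -> P (a *: u + v)) -> P 0 ->
  (forall x m, P (X x m)) -> (forall m, P (D m)) -> P K1 -> P K2 ->
  forall u, P u.

Let br0l v : br 0 v = 0.
Proof. by have := brPl v (-1) 0 0; rewrite scaler0 addr0 scaleN1r addNr. Qed.
Let br0r v : br v 0 = 0.
Proof. by have := brPr v (-1) 0 0; rewrite scaler0 addr0 scaleN1r addNr. Qed.
Let brDr u v w : br u (v + w) = br u v + br u w.
Proof. by rewrite -[v in LHS]scale1r brPr scale1r. Qed.
Let brZr u a v : br u (a *: v) = a *: br u v.
Proof. by rewrite -[a *: v in LHS]addr0 brPr br0r addr0. Qed.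
Let brNr u v : br u (- v) = - br u v.
Proof. by rewrite -[- v]scaleN1r brZr scaleN1r. Qed.
Let X0 m : X 0 m = 0.
Proof. by apply: (addrI (X 0 m)); rewrite XD !addr0. Qed.
Let XN x m : X (- x) m = - X x m.
Proof. by apply: (addrI (X x m)); rewrite XD !subrr X0. Qed.

Let brC u v : br u v = - br v u.
Proof.
elim/Vind: u v => [a u u' IH IH' v||x m v|m v|v|v].
- by rewrite brPl brPr IH IH' scalerN opprD.
- by move=> v; rewrite br0l br0r oppr0.
- elim/Vind: v => [a u u' IH IH'||y n|n||].
  + by rewrite brPl brPr IH IH' scalerN opprD.
  + by rewrite br0l br0r oppr0.
  + have E : m%:~R * kap x y *+ (m + n == 0)
        = - (n%:~R * kap y x *+ (m + n == 0)).
      rewrite (kapC y x) -mulNrn.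
      case: eqP => [/eqP|]; rewrite ?mulr0n// addr_eq0 => /eqP ->.
      by rewrite !mulr1n; ring.
    by rewrite !XX opprD -scaleNr (lieC x y) XN E [n + m]addrC.
  + by rewrite XDr DX.
  + by rewrite br1l br1r oppr0.
  + by rewrite br2l br2r oppr0.
- elim/Vind: v => [a u u' IH IH'||y n|n||].
  + by rewrite brPl brPr IH IH' scalerN opprD.
  + by rewrite br0l br0r oppr0.
  + by rewrite XDr DX opprK.
  + have E : (m ^+ 3 - m)%:~R / 12 *+ (m + n == 0)
        = - ((n ^+ 3 - n)%:~R / 12 *+ (m + n == 0)) :> K.
      rewrite -mulNrn.
      case: eqP => [/eqP|]; rewrite ?mulr0n// addr_eq0 => /eqP ->.
      by rewrite !mulr1n -mulNr; congr (_ / _); ring.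
    have E' : (n - m)%:~R = - (m - n)%:~R :> K by ring.
    by rewrite !DD opprD -!scaleNr E E' [n + m]addrC.
  + by rewrite br1l br1r oppr0.
  + by rewrite br2l br2r oppr0.
- by rewrite br1l br1r oppr0.
- by rewrite br2l br2r oppr0.
Qed.

Fact presented_liexx u : br u u = 0.
Proof.
have /eqP := brC u u; rewrite -addr_eq0 -mulr2n -scaler_nat scaler_eq0.
by rewrite pnatr_eq0 /= => /eqP.
Qed.

Let add3 (a b c d e f : V) :
  (a + b) + (c + d) + (e + f) = (a + c + e) + (b + d + f).
Proof. by rewrite [a + b + _]addrACA [LHS]addrACA. Qed.

Let J u v w := br u (br v w) + br v (br w u)
    + br w (br u v).

Let rot (a b c : V) : a + b + c = b + c + a.
Proof. by rewrite -addrA [LHS]addrC. Qed.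

Let JC u v w : J u v w = J v w u. Proof. exact: rot. Qed.

Let JP a u u' v w : J (a *: u + u') v w = a *: J u v w + J u' v w.
Proof.
by rewrite /J !brPl !brPr !scalerDr add3.
Qed.

Let J0 v w : J 0 v w = 0.
Proof. by rewrite /J br0l !br0r br0l br0r !addr0. Qed.
Let J1 v w : J K1 v w = 0.
Proof. by rewrite /J !br1l br1r !br0r !addr0. Qed.
Let J2 v w : J K2 v w = 0.
Proof. by rewrite /J !br2l br2r !br0r !addr0. Qed.

Let Jlll x m y n z p : J (X x m) (X y n) (X z p) = 0.
Proof.
rewrite /J !XX !brDr !brZr !br1r !scaler0 !addr0.
rewrite !XX.
have -> : n + (p + m) = m + (n + p) by ring.
have -> : p + (m + n) = m + (n + p) by ring.
rewrite add3 -!scalerDl !XD lie_jacobi X0 add0r.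
rewrite -(kap_lie y z x) (kapC (lie y z)).
rewrite (kapC z) (kap_lie x y z) -!mulrnDl -!mulrDl -!intrD -addrA.
by case: eqP => [->|_]; rewrite ?mulr0n ?mul0r ?mul0rn scale0r.
Qed.

Let Jlld x m y n p : J (X x m) (X y n) (D p) = 0.
Proof.
rewrite /J XX XDr DX !brDr !brNr !brZr br1r.
rewrite !XX DX scaler0 addr0 intrD.
have -> : n + (p + m) = p + (m + n) by ring.
have -> : m + (p + n) = p + (m + n) by ring.
rewrite (lieC y x) XN (kapC y x).
move: (X _ _) => L; rewrite !scalerDr !scalerN opprD !scalerA.
rewrite -!mulrnAr !mulrA [_ * n%:~R]mulrC scalerDl.
by rewrite [- _ - _ + _]addrACA addNr addr0 -opprD [m%:~R *: L + _]addrC addNr.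
Qed.

Let Jldd x m n p : J (X x m) (D n) (D p) = 0.
Proof.
rewrite /J DD XDr DX !brDr !brNr !brZr br2r.
rewrite !XDr !DX scaler0 addr0.
have -> : n + (p + m) = n + p + m by ring.
have -> : p + (n + m) = n + p + m by ring.
rewrite scalerN !scalerA -!scaleNr -!scalerDl.
set c := (X in X *: _); have -> : c = 0 by rewrite /c; ring.
exact: scale0r.
Qed.

Let Jddd m n p : J (D m) (D n) (D p) = 0.
Proof.
rewrite /J !DD !brDr !brZr !br2r !scaler0 !addr0 !DD.
have -> : n + (p + m) = m + (n + p) by ring.
have -> : p + (m + n) = m + (n + p) by ring.
rewrite !scalerDr !scalerA add3 -!scalerDl !mulrnAr.
set c := (X in X *: _ + _); have -> : c = 0 by rewrite /c; ring.
rewrite scale0r add0r -!mulrnDl.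
case: eqP => [/eqP|]; rewrite ?mulr0n ?scale0r// addr_eq0 => /eqP ->.
set c' := (X in X *: _); have -> : c' = 0 by rewrite /c'; ring.
exact: scale0r.
Qed.

Let JPm u a v v' w : J u (a *: v + v') w = a *: J u v w + J u v' w.
Proof. by have H v0 : J u v0 w = J v0 w u; [rewrite JC|rewrite !H JP]. Qed.

Let JPr u v a w w' : J u v (a *: w + w') = a *: J u v w + J u v w'.
Proof. by have H w0 : J u v w0 = J w0 u v; [rewrite 2!JC|rewrite !H JP]. Qed.

Let J0m u w : J u 0 w = 0. Proof. by rewrite JC J0. Qed.
Let J1m u w : J u K1 w = 0. Proof. by rewrite JC J1. Qed.
Let J2m u w : J u K2 w = 0. Proof. by rewrite JC J2. Qed.
Let J0r u v : J u v 0 = 0. Proof. by rewrite -JC J0. Qed.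
Let J1r u v : J u v K1 = 0. Proof. by rewrite -JC J1. Qed.
Let J2r u v : J u v K2 = 0. Proof. by rewrite -JC J2. Qed.

Fact presented_jacobi u v w :
  br u (br v w) + br v (br w u)
    + br w (br u v) = 0.
Proof.
rewrite -/(J u v w).
elim/Vind: u => [a u u' IH IH'||x m|m||].
- by rewrite JP IH IH' scaler0 addr0.
- exact: J0.
- elim/Vind: v => [a v v' IH IH'||y n|n||].
  + by rewrite JPm IH IH' scaler0 addr0.
  + exact: J0m.
  + elim/Vind: w => [a w w' IH IH'||z p|p||]; first last.
    * exact: J2r.
    * exact: J1r.
    * exact: Jlld.
    * exact: Jlll.
    * exact: J0r.
    * by rewrite JPr IH IH' scaler0 addr0.
  + elim/Vind: w => [a w w' IH IH'||z p|p||]; first last.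
    * exact: J2r.
    * exact: J1r.
    * exact: Jldd.
    * by rewrite -JC Jlld.
    * exact: J0r.
    * by rewrite JPr IH IH' scaler0 addr0.
  + exact: J1m.
  + exact: J2m.
- elim/Vind: v => [a v v' IH IH'||y n|n||].
  + by rewrite JPm IH IH' scaler0 addr0.
  + exact: J0m.
  + elim/Vind: w => [a w w' IH IH'||z p|p||]; first last.
    * exact: J2r.
    * exact: J1r.
    * by rewrite JC Jldd.
    * by rewrite JC Jlld.
    * exact: J0r.
    * by rewrite JPr IH IH' scaler0 addr0.
  + elim/Vind: w => [a w w' IH IH'||z p|p||]; first last.
    * exact: J2r.
    * exact: J1r.
    * exact: Jddd.
    * by rewrite -JC Jldd.
    * exact: J0r.
    * by rewrite JPr IH IH' scaler0 addr0.
  + exact: J1m.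
  + exact: J2m.
- exact: J1.
- exact: J2.
Qed.

End Presented.

Section AffineVirasoro.
Variables (K : numFieldType) (g : finLieAlgType K).

(* (g ⊗ K[t, t^-1]) + (span of the d_m) + K K_1 + K K_2.
   In the Witt part, << a *g m >> stands for a d_m. *)
Record affvir := AffVir {
  loop_part : laurent g;
  witt_part : {malg K[int]};
  K1_part : K;
  K2_part : K
}.

Let to_prod u := (loop_part u, witt_part u, K1_part u, K2_part u).
Let of_prod p := let: (x, d, k1, k2) := p in AffVir x d k1 k2.
Let to_prodK : cancel to_prod of_prod. Proof. by case. Qed.
HB.instance Definition _ := Choice.copy affvir (can_type to_prodK).

Definition av_add u v := AffVir (loop_part u + loop_part v)
  (witt_part u + witt_part v) (K1_part u + K1_part v) (K2_part u + K2_part v).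
Definition av_opp u := AffVir (- loop_part u) (- witt_part u)
  (- K1_part u) (- K2_part u).
Definition av_scale (a : K) u := AffVir (a *: loop_part u) (a *: witt_part u)
  (a * K1_part u) (a * K2_part u).

Fact av_addA : associative av_add.
Proof. by move=> u v w; rewrite /av_add/= !addrA. Qed.
Fact av_addC : commutative av_add.
Proof.
by move=> u v; congr AffVir; rewrite addrC.
Qed.
Fact av_add0 : left_id (AffVir 0 0 0 0) av_add.
Proof. by case=> x d k1 k2; rewrite /av_add/= !add0r. Qed.
Fact av_addN : left_inverse (AffVir 0 0 0 0) av_opp av_add.
Proof. by move=> u; rewrite /av_add/= !addNr. Qed.
HB.instance Definition _ :=
  GRing.isZmodule.Build affvir av_addA av_addC av_add0 av_addN.

Fact av_scaleA a b u : av_scale a (av_scale b u) = av_scale (a * b) u.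
Proof. by rewrite /av_scale/= !scalerA !mulrA. Qed.
Fact av_scale1 : left_id 1 av_scale.
Proof. by case=> x d k1 k2; rewrite /av_scale/= !scale1r !mul1r. Qed.
Fact av_scaleDr : right_distributive av_scale +%R.
Proof. by move=> a u v; congr AffVir; rewrite (scalerDr, mulrDr). Qed.
Fact av_scaleDl u : {morph av_scale^~ u : a b / a + b}.
Proof. by move=> a b; congr AffVir; rewrite (scalerDl, mulrDl). Qed.
HB.instance Definition _ := GRing.Zmodule_isLmodule.Build K affvir
  av_scaleA av_scale1 av_scaleDr av_scaleDl.

Definition av_loop (x : g) (m : int) : affvir := AffVir << x *g m >> 0 0 0.
Definition av_d (m : int) : affvir := AffVir 0 << 1 *g m >> 0 0.
Definition av_K1 : affvir := AffVir 0 0 1 0.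
Definition av_K2 : affvir := AffVir 0 0 0 1.

(* Structure constants: av_Bll x y is the coefficient of t^(m + n) in
   [x t^m, y t^n], av_Bdl that of [a d_m, y t^n], av_Bld that of - [x t^m, b d_n]
   and av_Bdd that of d_(m + n) in [a d_m, b d_n]; av_b1 and av_b2 are the
   cocycles, evaluated at n = - m.  The bracket on generators is given by
   av_loop_loop, av_d_loop, av_d_d, av_K1_central and av_K2_central. *)
Definition av_Bll (_ _ : int) (x y : g) : g := lie x y.
Definition av_Bdl (_ n : int) (a : K^o) (y : g) : g := (n%:~R * a) *: y.
Definition av_Bld (m _ : int) (x : g) (b : K^o) : g := (m%:~R * b) *: x.
Definition av_Bdd (m n : int) (a b : K^o) : K^o := (n - m)%:~R * (a * b).
Definition av_b1 (m : int) (x y : g) : K^o := m%:~R * killing x y.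
Definition av_b2 (m : int) (a b : K^o) : K^o := (m ^+ 3 - m)%:~R / 12 * (a * b).

Definition av_bracket (u v : affvir) : affvir := AffVir
  (gmul av_Bll (loop_part u) (loop_part v)
    + gmul av_Bdl (witt_part u) (loop_part v)
    - gmul av_Bld (loop_part u) (witt_part v))
  (gmul av_Bdd (witt_part u) (witt_part v))
  (gpair av_b1 (loop_part u) (loop_part v))
  (gpair av_b2 (witt_part u) (witt_part v)).

Lemma affvirP (u v : affvir) : loop_part u = loop_part v ->
    witt_part u = witt_part v -> K1_part u = K1_part v ->
    K2_part u = K2_part v -> u = v.
Proof. by case: u v => [????] [????] /= -> -> -> ->. Qed.

Let Blll m n v : linear (av_Bll m n ^~ v).
Proof. exact: (lie_bilinear.1 v). Qed.
Let Bllr m n u : linear (av_Bll m n u).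
Proof. exact: (lie_bilinear.2 u). Qed.
Let Bdll m n v : linear (av_Bdl m n ^~ v).
Proof. by move=> a x y; rewrite /av_Bdl mulrDr scalerDl scalerA mulrCA. Qed.
Let Bdlr m n u : linear (av_Bdl m n u).
Proof. by move=> a x y; rewrite /av_Bdl scalerDr !scalerA mulrC. Qed.
Let Bldl m n v : linear (av_Bld m n ^~ v).
Proof. by move=> a x y; rewrite /av_Bld scalerDr !scalerA mulrC. Qed.
Let Bldr m n u : linear (av_Bld m n u).
Proof. by move=> a x y; rewrite /av_Bld mulrDr scalerDl scalerA mulrCA. Qed.
Let Bddl m n v : linear (av_Bdd m n ^~ v).
Proof. by move=> a x y; rewrite /av_Bdd /GRing.scale/=; ring. Qed.
Let Bddr m n u : linear (av_Bdd m n u).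
Proof. by move=> a x y; rewrite /av_Bdd /GRing.scale/=; ring. Qed.
Let b1l m v : linear (av_b1 m ^~ v).
Proof.
by move=> a x y; rewrite /av_b1 killing_linear /GRing.scale/=; ring.
Qed.
Let b1r m u : linear (av_b1 m u).
Proof.
move=> a x y; rewrite /av_b1 killingC killing_linear /GRing.scale/=.
by rewrite !(killingC u); ring.
Qed.
Let b2l m v : linear (av_b2 m ^~ v).
Proof. by move=> a x y; rewrite /av_b2 /GRing.scale/=; ring. Qed.
Let b2r m u : linear (av_b2 m u).
Proof. by move=> a x y; rewrite /av_b2 /GRing.scale/=; ring. Qed.

Lemma loop_partP a (u v : affvir) m :
  (loop_part (a *: u + v))@_m = a *: (loop_part u)@_m + (loop_part v)@_m.
Proof. by rewrite mcoeffD laurentZE. Qed.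

Lemma witt_partP a (u v : affvir) m :
  (witt_part (a *: u + v))@_m
    = a *: ((witt_part u)@_m : K^o) + (witt_part v)@_m.
Proof. by rewrite mcoeffD mcoeffZ. Qed.

Let coef3 (x y z : laurent g) m : (x + y - z)@_m = x@_m + y@_m - z@_m.
Proof. by rewrite mcoeffB mcoeffD. Qed.

Let addr6 a (x y z x1 x2 x3 y1 y2 y3 : g) :
    x = a *: x1 + y1 -> y = a *: x2 + y2 -> z = a *: x3 + y3 ->
  x + y - z = a *: (x1 + x2 - x3) + (y1 + y2 - y3).
Proof.
move=> -> -> ->; rewrite scalerBr scalerDr opprD.
by rewrite [a *: x1 + y1 + _]addrACA [LHS]addrACA.
Qed.

Let av_bracketPl w a u v :
  av_bracket (a *: u + v) w = a *: av_bracket u w + av_bracket v w.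
Proof.
apply: affvirP => /=; [apply/malgP => m | apply/malgP => m | |].
- rewrite [LHS]coef3 [RHS]mcoeffD laurentZE.
  rewrite [X in _ = _ *: X + _]coef3 [X in _ = _ + X]coef3; apply: addr6.
  + exact: (gmulPl Blll Bllr _ _ (loop_partP a u v)).
  + exact: (gmulPl Bdll Bdlr _ _ (witt_partP a u v)).
  + exact: (gmulPl Bldl Bldr _ _ (loop_partP a u v)).
- rewrite [RHS]mcoeffD mcoeffZ.
  exact: (gmulPl Bddl Bddr _ _ (witt_partP a u v)).
- exact: (gpairPl b1l _ (loop_partP a u v)).
- exact: (gpairPl b2l _ (witt_partP a u v)).
Qed.

Let av_bracketPr w a u v :
  av_bracket w (a *: u + v) = a *: av_bracket w u + av_bracket w v.
Proof.
apply: affvirP => /=; [apply/malgP => m | apply/malgP => m | |].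
- rewrite [LHS]coef3 [RHS]mcoeffD laurentZE.
  rewrite [X in _ = _ *: X + _]coef3 [X in _ = _ + X]coef3; apply: addr6.
  + exact: (gmulPr Blll Bllr _ _ (loop_partP a u v)).
  + exact: (gmulPr Bdll Bdlr _ _ (loop_partP a u v)).
  + exact: (gmulPr Bldl Bldr _ _ (witt_partP a u v)).
- rewrite [RHS]mcoeffD mcoeffZ.
  exact: (gmulPr Bddl Bddr _ _ (witt_partP a u v)).
- exact: (gpairPr b1r _ (loop_partP a u v)).
- exact: (gpairPr b2r _ (witt_partP a u v)).
Qed.

Fact av_bilinear : bilinear_for *:%R *:%R av_bracket.
Proof. exact (av_bracketPl, av_bracketPr). Qed.

Lemma affvir_ind (P : affvir -> Prop) :
    (forall a u v, P u -> P v -> P (a *: u + v)) -> P 0 ->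
    (forall x m, P (av_loop x m)) -> (forall m, P (av_d m)) ->
    P av_K1 -> P av_K2 ->
  forall u, P u.
Proof.
move=> PD P0 Px Pd P1 P2 [u1 u2 u3 u4].
have -> : AffVir u1 u2 u3 u4 = 1 *: AffVir u1 0 0 0 +
    (1 *: AffVir 0 u2 0 0 + (u3 *: av_K1 + (u4 *: av_K2 + 0))).
  apply: affvirP => /=.
  - by rewrite !scaler0 !addr0 scale1r.
  - by rewrite !scaler0 !addr0 scale1r add0r.
  - by rewrite !mulr0 !addr0 !add0r mulr1.
  - by rewrite !mulr0 !addr0 !add0r mulr1.
apply: (PD).
  rewrite [u1]monalgE; elim: (enum_fset (msupp u1)) => [|m s IH].
    by rewrite big_nil; exact: P0.
  have := PD 1 _ _ (Px u1@_m m) IH; rewrite scale1r big_cons.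
  by congr P; apply: affvirP => //; exact: addr0.
apply: (PD); last by apply: (PD) => //; apply: (PD).
rewrite [u2]monalgE; elim: (enum_fset (msupp u2)) => [|m s IH].
  by rewrite big_nil; exact: P0.
have := PD u2@_m _ _ (Pd m) IH; rewrite big_cons.
congr P; apply: affvirP => /=.
- by rewrite ?scaler0 ?mulr0 addr0.
- congr (_ + _); apply/malgP => k; rewrite mcoeffZ !mcoeffU.
  by case: eqP; rewrite ?mulr1n ?mulr1 ?mulr0n ?mulr0.
- by rewrite ?scaler0 ?mulr0 addr0.
- by rewrite ?scaler0 ?mulr0 addr0.
Qed.

Lemma av_loop_loop x m y n :
  av_bracket (av_loop x m) (av_loop y n) =
  av_loop (lie x y) (m + n) + (m%:~R * killing x y *+ (m + n == 0)) *: av_K1.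
Proof.
apply: affvirP => /=.
- by rewrite (gmulUU Blll Bllr) gmul0l gmul0r subr0 !(scaler0, mulr0).
- by rewrite gmul0l !(scaler0, mulr0) addr0.
- by rewrite (gpairUU b1l b1r) add0r [RHS]mulr1.
- by rewrite gpair0l !(scaler0, mulr0) addr0.
Qed.

Lemma av_d_loop m x n :
  av_bracket (av_d m) (av_loop x n) = n%:~R *: av_loop x (m + n).
Proof.
apply: affvirP => /=.
- by rewrite (gmulUU Bdll Bdlr) !gmul0l subr0 add0r laurentZU /av_Bdl mulr1.
- by rewrite gmul0r !(scaler0, mulr0).
- by rewrite gpair0l !(scaler0, mulr0).
- by rewrite (gpair0r b2r) !(scaler0, mulr0).
Qed.

Lemma av_d_d m n :
  av_bracket (av_d m) (av_d n) = (n - m)%:~R *: av_d (m + n)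
    + ((m ^+ 3 - m)%:~R / 12 *+ (m + n == 0)) *: av_K2.
Proof.
apply: affvirP => /=.
- by rewrite !gmul0l gmul0r subr0 !(scaler0, mulr0).
- rewrite (gmulUU Bddl Bddr) !(scaler0, mulr0) addr0; apply/malgP => k.
  by rewrite mcoeffZ !mcoeffU /av_Bdd mulr1 mulrnAr.
- by rewrite gpair0l !(scaler0, mulr0) addr0.
- rewrite (gpairUU b2l b2r) !(scaler0, mulr0) add0r [RHS]mulr1.
  by rewrite /av_b2 !mulr1.
Qed.

Let av_loop_d x m n :
  av_bracket (av_loop x m) (av_d n) = - (m%:~R *: av_loop x (n + m)).
Proof.
apply: affvirP => /=.
- rewrite (gmulUU Bldl Bldr) !gmul0l gmul0r addr0 sub0r laurentZU /av_Bld mulr1.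
  by rewrite addrC.
- by rewrite gmul0l !(scaler0, mulr0) oppr0.
- by rewrite (gpair0r b1r) !(scaler0, mulr0) oppr0.
- by rewrite gpair0l !(scaler0, mulr0) oppr0.
Qed.

Let centrall (u v : affvir) : loop_part u = 0 -> witt_part u = 0 ->
  av_bracket u v = 0.
Proof.
rewrite /av_bracket => -> ->; rewrite !gmul0l !gpair0l.
by apply: affvirP => //=; rewrite /= subr0 addr0.
Qed.

Let centralr (u v : affvir) : loop_part v = 0 -> witt_part v = 0 ->
  av_bracket u v = 0.
Proof.
rewrite /av_bracket => -> ->; rewrite !gmul0r (gpair0r b1r) (gpair0r b2r).
by apply: affvirP => //=; rewrite /= subr0 addr0.
Qed.

Lemma av_K1_central u : av_bracket u av_K1 = 0. Proof. exact: centralr. Qed.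
Lemma av_K2_central u : av_bracket u av_K2 = 0. Proof. exact: centralr. Qed.

Let br1l v : av_bracket av_K1 v = 0. Proof. exact: centrall. Qed.
Let br2l v : av_bracket av_K2 v = 0. Proof. exact: centrall. Qed.
Let av_loopD x y m : av_loop x m + av_loop y m = av_loop (x + y) m.
Proof. by apply: affvirP => /=; rewrite ?addr0// monalgUD. Qed.
Fact av_bracketxx u : av_bracket u u = 0.
Proof.
apply: (@presented_liexx K g (@killing K g) affvir av_bracket
  av_loop av_d av_K1 av_K2);
[exact: av_bracketPl | exact: av_bracketPr | exact: av_loop_loop
| exact: av_d_loop | exact: av_loop_d | exact: av_d_d | exact: br1l
| exact: br2l | exact: av_K1_central | exact: av_K2_central
| exact: av_loopD | exact: killingC | exact: affvir_ind].
Qed.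

Fact av_jacobi u v w :
  av_bracket u (av_bracket v w) + av_bracket v (av_bracket w u)
    + av_bracket w (av_bracket u v) = 0.
Proof.
apply: (@presented_jacobi K g (@killing K g) affvir av_bracket
  av_loop av_d av_K1 av_K2);
[exact: av_bracketPl | exact: av_bracketPr | exact: av_loop_loop
| exact: av_d_loop | exact: av_loop_d | exact: av_d_d | exact: br1l
| exact: br2l | exact: av_K1_central | exact: av_K2_central
| exact: av_loopD | exact: killingC
| exact: killing_lie | exact: affvir_ind].
Qed.

HB.instance Definition _ := isLieAlgebra.Build K affvir
  av_bilinear av_bracketxx av_jacobi.

Lemma lie_affvirE (u v : affvir) : lie u v = av_bracket u v.
Proof. by []. Qed.

End AffineVirasoro.

Section Biderivation.
Variables (K : comNzRingType) (L : lieAlgType K).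

Definition biderivation (F : L -> L -> L) : Prop :=
  [/\ (bilinear_for *:%R *:%R F : Prop),
      (forall x y z, F (lie x y) z = lie x (F y z) - lie y (F x z))
    & (forall x y z, F x (lie y z) = lie y (F x z) - lie z (F x y))].

Definition inner_biderivation (F : L -> L -> L) : Prop :=
  exists lambda : K, forall x y, F x y = lambda *: lie x y.

End Biderivation.

(* Main.v *)
Require Import Defs.
From HB Require Import structures.
From mathcomp Require Import all_boot all_order all_algebra.
From mathcomp.multinomials Require Import monalg.
From mathcomp Require Import boolp reals complex spectral.
From mathcomp Require Import ring.

Set Implicit Arguments.
Unset Strict Implicit.
Unset Printing Implicit Defensive.

Import Order.TTheory GRing.Theory Num.Theory passmx.
Local Open Scope ring_scope.

(** Write [X x m] for x t^m and [d m] for d_m, let [d 0] grade the algebra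
    (X x m and d m have weight m, K_1 and K_2 weight 0), and let F be a
    biderivation.  The plan is to show that F is determined by F(d_0, .), and
    that F(d_0, .) is a multiple of the bracket.

    Applying the derivation rule of F to [d_0, u] = n u gives
      [d_0, F(u, v)] - n F(u, v) = [u, F(d_0, v)]      (u of weight n),
    and symmetrically in the second argument (bider_weightl, bider_weightr).
    The left side has no part of weight n, so the weight 0 part of F(d_0, v)
    commutes, up to K_1 and K_2, with every u; as g has no centre, that part
    lies in the span of K_1 and K_2.  This makes F(d_0, d_0) central, and then
    F(d_0, .) preserves weights (weight_d0).  Comparing the two rules in weight
    n + m gives
      n [u, F(d_0, v)] = m [v, F(u, d_0)]   (u, v of weights n, m),
    and letting u, v run through the d_n and the X x m leaves only
    F(d_0, v) = c [d_0, v] up to the centre, with one constant c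
    (bider_d0_scalar).

    Subtracting c [., .] we may assume that F(d_0, .) is central.  Then it is 0,
    because the algebra is perfect; so F(u, .) has values in the weight n of u.
    But F(u, [a, b]) = [a, F(u, b)] - [b, F(u, a)] lies in the weights
    n + deg a and n + deg b, hence is central once deg a and deg b are nonzero;
    such brackets span everything (affvir_lie_ind), so F is central-valued,
    hence 0 by perfectness once more (bider_d0_eq0).

    Perfectness is where the structure of g matters: K_1 lies in the derived
    algebra only if the Killing form is not identically 0, and otherwise
    (u, v) -> k_1(u) k_1(v) K_1, with k_1(u) the coefficient of K_1 in u, would be
    a biderivation that is not inner.  So one needs a weak form of Cartan's
    criterion (killing_neq0).  Suppose the Killing form vanishes, and fix x.
    Take a polynomial q such that q(ad x) acts on the generalized eigenspace of
    each eigenvalue r as the complex conjugate r^*.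
    Conjugation is additive, so q(ad x) is a derivation of g
    (conj_derivation); since x is a sum of brackets, tr(ad x q(ad x)) is then a
    sum of values of the Killing form (trace_ad_derivation), i.e. 0.  But it is
    also the sum of the |r|^2, so ad x is nilpotent.  Engel's theorem
    (engel_common_vector) then gives g a nonzero centre, which contradicts
    simplicity. *)

(** * Polynomials of a matrix, and its generalized eigenspaces *)

Section PolynomialsOfMatrices.
Variables (K : fieldType) (n : nat).
Implicit Types (A B T : 'M[K]_n.+1) (p q : {poly K}) (u : 'rV[K]_n.+1).

Lemma trig_mul A B (i : 'I_n.+1) : is_trig_mx A -> is_trig_mx B ->
  (A *m B) i i = A i i * B i i.
Proof.
move=> /is_trig_mxP Atrig /is_trig_mxP Btrig; rewrite mxE (bigD1 i)//= big1 ?addr0//.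
move=> j; rewrite -val_eqE /= neq_ltn => /orP[ji|ij].
  by rewrite (Btrig j i ji) mulr0.
by rewrite (Atrig i j ij) mul0r.
Qed.

Lemma is_trig_mxM A B : is_trig_mx A -> is_trig_mx B -> is_trig_mx (A *m B).
Proof.
move=> /is_trig_mxP Atrig /is_trig_mxP Btrig; apply/is_trig_mxP => i j ij.
rewrite mxE big1// => k _; case: (leqP k i) => [ki|ik].
  by rewrite (Btrig k j) ?mulr0// (leq_ltn_trans ki).
by rewrite Atrig ?mul0r.
Qed.

(** Lets the trace of a polynomial of T be read off the diagonal of T. *)
Lemma horner_mx_trig T p : is_trig_mx T ->
  is_trig_mx (horner_mx T p) /\ forall i, horner_mx T p i i = p.[T i i].
Proof.
move=> Ttrig; elim/poly_ind: p => [|p c [pT pTi]].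
  by rewrite rmorph0 mx0_is_trig; split=> // i; rewrite mxE horner0.
rewrite rmorphD rmorphM /= horner_mx_X horner_mx_C; split=> [|i].
  apply/is_trig_mxP => i j ij; rewrite mxE.
  move/is_trig_mxP: (is_trig_mxM pT Ttrig) => ->//.
  by move/is_trig_mxP: (scalar_mx_is_trig n.+1 c) => ->//; rewrite addr0.
by rewrite mxE trig_mul// pTi !hornerE mxE eqxx mulr1n.
Qed.

Lemma coprimep_XsubC_exp (a b : K) i j : a != b ->
  coprimep (('X - a%:P) ^+ i) (('X - b%:P) ^+ j).
Proof.
by move=> ab; rewrite coprimep_expl// coprimep_expr// coprimep_XsubC root_XsubC eq_sym.
Qed.

Lemma coprimep_XsubC_prod (a : K) i j (rs : seq K) : a \notin rs ->
  coprimep (('X - a%:P) ^+ i) (\prod_(r <- rs) ('X - r%:P) ^+ j).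
Proof.
elim: rs => [|r rs IH]; first by rewrite big_nil coprimep1.
rewrite in_cons negb_or big_cons coprimepMr => /andP[ar /IH ->].
by rewrite coprimep_XsubC_exp.
Qed.

(** Interpolation to order N: such a q acts on the generalized eigenspace of r
    as the scalar c r. *)
Lemma poly_interpolation (c : K -> K) N (rs : seq K) : uniq rs ->
  exists q, forall r, r \in rs -> ('X - r%:P) ^+ N %| q - (c r)%:P.
Proof.
elim: rs => [|r rs IH] /=; first by exists 0.
case/andP=> rrs /IH[q qP].
have /Bezout_eq1_coprimepP[[a b] /= ab1] := coprimep_XsubC_prod N N rrs.
set p := _ ^+ N in ab1; set s := \prod_(_ <- _) _ in ab1.
exists (q + b * s * ((c r)%:P - q)) => x; rewrite in_cons => /orP[/eqP->|xrs].
  have -> : q + b * s * ((c r)%:P - q) - (c r)%:P = (q - (c r)%:P) * a * p.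
    have -> : b * s = 1 - a * p by rewrite -ab1; ring.
    by ring.
  exact: dvdp_mulIr.
rewrite addrAC dvdp_add ?qP// -mulrA dvdp_mull// dvdp_mulr//.
by rewrite /s (big_rem x xrs) dvdp_mulIl.
Qed.

(** The decomposition of a vector into generalized eigenvectors, stated as an
    induction principle for the additive predicates used below. *)
Lemma generalized_eigenvector_ind (Q : 'rV[K]_n.+1 -> Prop) A N (rs : seq K) :
  uniq rs -> Q 0 -> (forall u v, Q u -> Q v -> Q (u + v)) ->
  (forall r u, r \in rs -> u *m horner_mx A (('X - r%:P) ^+ N) = 0 -> Q u) ->
  forall u, u *m horner_mx A (\prod_(r <- rs) ('X - r%:P) ^+ N) = 0 -> Q u.
Proof.
move=> + Q0 QD; elim: rs => [|r rs IH] /=.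
  by move=> _ _ u; rewrite big_nil rmorph1 mulmx1 => ->.
case/andP=> rrs urs Qrs u.
have /Bezout_eq1_coprimepP[[a b] /= ab1] := coprimep_XsubC_prod N N rrs.
rewrite big_cons; set p := _ ^+ N in ab1 *; set s := \prod_(_ <- _) _ in ab1 *.
move=> ups; have kill x : u *m horner_mx A (p * s * x) = 0.
  by rewrite rmorphM -mulmxE mulmxA ups mul0mx.
have -> : u = u *m horner_mx A (a * p + b * s) by rewrite ab1 rmorph1 mulmx1.
rewrite rmorphD mulmxDr.
apply: QD.
  apply: IH => // [x v xrs|]; first by apply: Qrs; rewrite in_cons xrs orbT.
  rewrite -mulmxA mulmxE -rmorphM -/s (_ : a * p * s = p * s * a) ?kill//; ring.
apply: (Qrs r); first by rewrite mem_head.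
rewrite -mulmxA mulmxE -rmorphM -/p (_ : b * s * p = p * s * b) ?kill//; ring.
Qed.

End PolynomialsOfMatrices.

(** * The derivation conjugate to a given one *)

Section ConjugateDerivation.
Variables (C : numClosedFieldType).

Definition mx_derivation n (b : 'rV[C]_n -> 'rV[C]_n -> 'rV[C]_n) (D : 'M[C]_n) :=
  forall u v, b u v *m D = b (u *m D) v + b u (v *m D).

Section Derivation.
Variables (n : nat) (b : 'rV[C]_n.+1 -> 'rV[C]_n.+1 -> 'rV[C]_n.+1).
Hypothesis b_linl : forall v, linear (b^~ v).
Hypothesis b_linr : forall u, linear (b u).
Variable A : 'M[C]_n.+1.
Hypothesis A_der : mx_derivation b A.

Let b0l v : b 0 v = 0.
Proof. by have := b_linl v (-1) 0 0; rewrite scaler0 addr0 scaleN1r addNr. Qed.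
Let b0r v : b v 0 = 0.
Proof. by have := b_linr v (-1) 0 0; rewrite scaler0 addr0 scaleN1r addNr. Qed.
Let bDl v u w : b (u + w) v = b u v + b w v.
Proof. by rewrite -[u]scale1r b_linl !scale1r. Qed.
Let bDr v u w : b v (u + w) = b v u + b v w.
Proof. by rewrite -[u]scale1r b_linr !scale1r. Qed.
Let bZl v a u : b (a *: u) v = a *: b u v.
Proof. by rewrite -[_ *: u]addr0 b_linl b0l addr0. Qed.
Let bZr v a u : b v (a *: u) = a *: b v u.
Proof. by rewrite -[_ *: u]addr0 b_linr b0r addr0. Qed.

(** Because A - (x + y) acts on [b u v] as A - x on [u] plus A - y on [v], each
    term of the (i + j)-th power has i factors on [u] or j factors on [v]. *)
Lemma bracket_generalized_eigenspace x y i j u v :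
    u *m horner_mx A (('X - x%:P) ^+ i) = 0 ->
    v *m horner_mx A (('X - y%:P) ^+ j) = 0 ->
  b u v *m horner_mx A (('X - (x + y)%:P) ^+ (i + j)) = 0.
Proof.
have [k] := ubnP (i + j); elim: k => // k IH in i j u v *; rewrite ltnS => ijk.
case: i => [|i] in ijk *; first by rewrite rmorph1 mulmx1 => ->; rewrite b0l mul0mx.
case: j => [|j] in ijk *; first by rewrite rmorph1 mulmx1 => _ ->; rewrite b0r mul0mx.
move=> ui vj; rewrite addSn exprS rmorphM -mulmxE mulmxA.
have HX z w : w *m horner_mx A ('X - z%:P) = w *m A - z *: w.
  by rewrite rmorphB /= horner_mx_X horner_mx_C mulmxBr mul_mx_scalar.
have -> : b u v *m horner_mx A ('X - (x + y)%:P)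
    = b (u *m horner_mx A ('X - x%:P)) v + b u (v *m horner_mx A ('X - y%:P)).
  rewrite !HX A_der bDl bDr -!scaleNr bZl bZr !scaleNr scalerDl opprD.
  by rewrite addrACA.
rewrite mulmxDl IH ?add0r//; last first.
  by rewrite -mulmxA mulmxE -rmorphM -exprS.
rewrite -addSnnS; apply: IH => //.
- by rewrite addSnnS.
by rewrite -mulmxA mulmxE -rmorphM -exprS.
Qed.

(** The conjugate derivation is q(A), where q interpolates conjugation to a high
    enough order; the trace of A q(A) is the sum of the |r|^2 over the
    eigenvalues r, so it vanishes only if A is nilpotent. *)
Lemma conj_derivationS : exists D, mx_derivation b D /\
  (\tr (A *m D) = 0 -> forall u, iter n.+1 (fun v : 'rV[C]__ => v *m A) u = 0).
Proof.
have [P /unitarymx_unit Pu] := Schur A isT; rewrite /similar_to conjumx//.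
set T := P *m A *m invmx P => Ttrig.
have AE : A = invmx P *m T *m P by rewrite /T !mulmxA mulVmx// mul1mx mulmxKV.
clearbody T.
pose rs := undup [seq T i i | i <- enum 'I_n.+1].
have Trs i : T i i \in rs.
  by rewrite mem_undup; apply/mapP; exists i; rewrite ?mem_enum.
(* The bracket of the spaces of x and y is killed by a power of A - (x + y),
   whether or not x + y is an eigenvalue: so q interpolates at all these sums,
   and to twice the order. *)
pose sums := [seq x + y | x <- rs, y <- rs].
have [q qP] := poly_interpolation (fun z : C => z^*) (n.+1 + n.+1)
  (undup_uniq (rs ++ sums)).
pose D := horner_mx A q.
have DE r (u : 'rV_n.+1) k : r \in rs ++ sums -> (k <= n.+1 + n.+1)%N ->
    u *m horner_mx A (('X - r%:P) ^+ k) = 0 -> u *m D = r^* *: u.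
  rewrite -mem_undup => /qP /dvdpP[s sE] kN uk.
  rewrite /D; have -> : q = (r^*)%:P
      + ('X - r%:P) ^+ k * (('X - r%:P) ^+ (n.+1 + n.+1 - k) * s).
    by rewrite mulrA -exprD subnKC// mulrC -sE; ring.
  rewrite rmorphD rmorphM /= horner_mx_C mulmxDr mul_mx_scalar mulmxA.
  by rewrite uk mul0mx addr0.
have dec (Q : 'rV[C]_n.+1 -> Prop) : Q 0 -> (forall u v, Q u -> Q v -> Q (u + v)) ->
  (forall r u, r \in rs -> u *m horner_mx A (('X - r%:P) ^+ n.+1) = 0 -> Q u) ->
  forall u, Q u.
  move=> Q0 QD Qrs u; apply: (generalized_eigenvector_ind (undup_uniq _) Q0 QD Qrs).
  suff -> : horner_mx A (\prod_(r <- rs) ('X - r%:P) ^+ n.+1) = 0 by rewrite mulmx0.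
  have : char_poly T %| \prod_(r <- rs) ('X - r%:P) ^+ n.+1.
    rewrite prodrXl char_poly_trig// -[X in _ ^+ X]card_ord -prodr_const.
    apply: (big_ind2 (fun x y : {poly C} => x %| y)) => [//|? ? ? ?|i _].
      exact: dvdp_mul.
    by rewrite (big_rem _ (Trs i)) dvdp_mulIl.
  case/dvdpP=> s ->; rewrite rmorphM /= AE.
  by rewrite [X in _ * X]horner_mx_uconjC// Cayley_Hamilton mulmx0 mul0mx mulr0.
have subrs r : r \in rs -> r \in rs ++ sums by rewrite mem_cat => ->.
exists D; split.
  move=> u v; elim/dec: u => [|u u' IH IH'|x u xrs ux].
  - by rewrite !mul0mx !b0l !mul0mx addr0.
  - by rewrite bDl !mulmxDl !bDl IH IH' addrACA.
  elim/dec: v => [|v v' IH IH'|y v yrs vy].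
  - by rewrite !mul0mx !b0r !mul0mx addr0.
  - by rewrite bDr !mulmxDl !bDr IH IH' addrACA.
  rewrite (DE x u n.+1) ?subrs ?leq_addr// (DE y v n.+1) ?subrs ?leq_addr//.
  rewrite bZl bZr -scalerDl -rmorphD; apply: (DE _ _ (n.+1 + n.+1)%N) => //.
    by rewrite mem_cat orbC allpairs_f.
  exact: bracket_generalized_eigenspace.
have TrE : \tr (A *m D) = \sum_i `|T i i| ^+ 2.
  have DT : D = invmx P *m horner_mx T q *m P.
    by rewrite /D AE horner_mx_uconjC.
  rewrite DT AE -!mulmxA (mulmxA P) mulmxV// mul1mx mxtrace_mulC.
  rewrite -!mulmxA mulmxV// mulmx1.
  have [hT hTi] := horner_mx_trig q Ttrig.
  apply: eq_bigr => i _; rewrite trig_mul// hTi normCK; congr (_ * _).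
  have := subrs _ (Trs i); rewrite -mem_undup => /qP /(dvdp_trans _) qT.
  have /qT : 'X - (T i i)%:P %| ('X - (T i i)%:P) ^+ (n.+1 + n.+1).
    by rewrite addSn exprS dvdp_mulIl.
  by rewrite dvdp_XsubCl /root !hornerE subr_eq0 => /eqP.
rewrite TrE => /eqP; rewrite psumr_eq0 => [/allP T0 u|i _]; last exact: exprn_ge0.
have {}T0 i : T i i = 0.
  apply/eqP; rewrite -normr_eq0 -sqrf_eq0.
  by apply: (implyP (T0 i _)); rewrite ?mem_index_enum.
have charT : char_poly T = 'X ^+ n.+1.
  rewrite char_poly_trig//; under eq_bigr do rewrite T0 subr0.
  by rewrite prodr_const card_ord.
have An : A ^+ n.+1 = 0.
  have -> : A ^+ n.+1 = horner_mx A (char_poly T).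
    by rewrite charT rmorphXn /= horner_mx_X.
  by rewrite AE horner_mx_uconjC// Cayley_Hamilton mulmx0 mul0mx.
suff -> k w : iter k (fun v : 'rV[C]__ => v *m A) w = w *m A ^+ k.
  by rewrite An mulmx0.
elim: k => [|k IH]; first by rewrite expr0 mulmx1.
by rewrite iterS IH -mulmxA mulmxE -exprSr.
Qed.
End Derivation.

Lemma conj_derivation n (b : 'rV[C]_n -> 'rV[C]_n -> 'rV[C]_n) (A : 'M[C]_n) :
    (forall v, linear (b^~ v)) -> (forall u, linear (b u)) ->
    mx_derivation b A ->
  exists D, mx_derivation b D /\
    (\tr (A *m D) = 0 -> forall u, iter n (fun v : 'rV[C]__ => v *m A) u = 0).
Proof.
case: n => [|n] in b A *; last by move=> bl br; apply: conj_derivationS bl br _.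
by move=> _ _ _; exists 0; split=> [u v|_ u]; apply/rowP => -[].
Qed.
End ConjugateDerivation.

(** * Simple Lie algebras: centre, perfectness, Engel's theorem *)

Section LieLinear.
Variables (K : comNzRingType) (L : lieAlgType K).
Implicit Types (x y z : L) (a : K).

Lemma lie_addl x y z : lie (x + y) z = lie x z + lie y z.
Proof. by rewrite lieC linearD /= opprD -!(lieC _ z). Qed.
Lemma lie_addr x y z : lie x (y + z) = lie x y + lie x z.
Proof. exact: linearD. Qed.
Lemma lie_0r x : lie x (0 : L) = 0.
Proof. exact: linear0. Qed.
Lemma lie_0l x : lie (0 : L) x = 0.
Proof. by rewrite lieC lie_0r oppr0. Qed.
Lemma lie_scaler a x y : lie x (a *: y) = a *: lie x y.
Proof. exact: linearZ. Qed.
Lemma lie_scalel a x y : lie (a *: x) y = a *: lie x y.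
Proof. by rewrite lieC lie_scaler (lieC x) scalerN. Qed.
Lemma lie_oppr x y : lie x (- y) = - lie x y.
Proof. exact: linearN. Qed.
Lemma lie_leibniz x y z :
  lie x (lie y z) = lie (lie x y) z + lie y (lie x z).
Proof.
have /eqP := lie_jacobi x y z; rewrite (lieC z x) (lieC z (lie x y)) lie_oppr.
by rewrite -addrA -opprD subr_eq0 addrC => /eqP.
Qed.

End LieLinear.

Section SimpleAlgebra.
Variables (K : fieldType) (g : finLieAlgType K).
HB.instance Definition _ := GRing.isLinear.Build K g 'End(g) *:%R (@ad K g)
  (@ad_linear K g).

Hypothesis g_simple : lie_simple g.

Lemma lie_simple_center (y : g) : (forall x, lie x y = 0) -> y = 0.
Proof.
have in_ker (z : g) : reflect (forall x, lie x z = 0) (z \in lker (linfun (@ad K g))).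
  rewrite memv_ker lfunE; apply: (iffP eqP) => /= [adz x|zC].
    by rewrite lieC -adE adz lfunE oppr0.
  by apply/lfunP => x; rewrite adE lieC zC oppr0 lfunE.
have [[u [v uv]] ideals] := g_simple.
have [|k0|kg] := ideals (lker (linfun (@ad K g))).
- by move=> x z /in_ker zC; rewrite zC mem0v.
- by move=> /in_ker; rewrite k0 memv0 => /eqP.
by case: uv; have /in_ker -> : v \in lker (linfun (@ad K g)) by rewrite kg memvf.
Qed.

(** A simple Lie algebra is perfect, since its derived algebra is a nonzero
    ideal. *)
Lemma lie_simple_ind (P : g -> Prop) : (forall a x y, P x -> P y -> P (a *: x + y)) ->
  P 0 -> (forall x y, P (lie x y)) -> forall x, P x.
Proof.
move=> PD P0 Plie x.
pose I := <<[seq lie y z | y <- vbasis {:g}, z <- vbasis {:g}]>>%VS.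
have lieI y z : lie y z \in I.
  rewrite (coord_vbasis (memvf y)) (coord_vbasis (memvf z)).
  rewrite linear_sum /=; apply: memv_suml => i _.
  rewrite lie_scaler lieC linear_sum /= memvZ// memvN; apply: memv_suml => j _.
  rewrite linearZ /= memvZ// lieC memvN memv_span//.
  by apply: allpairs_f; rewrite mem_nth// size_tuple.
have [[u [v uv]] ideals] := g_simple.
have [|I0|Ig] := ideals I.
- by move=> y z _; apply: lieI.
- by case: uv; apply/eqP; rewrite -memv0 -I0.
pose s := [seq lie y z | y <- vbasis {:g}, z <- vbasis {:g}].
have xI : x \in <<in_tuple s>>%VS by rewrite -[X in <<X>>%VS]/s -/I Ig memvf.
rewrite (coord_span xI).
apply: big_ind => // [y z|i _].
  by move=> Py Pz; have := PD 1 _ _ Py Pz; rewrite scale1r.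
rewrite -[_ *: _]addr0; apply: PD => //.
have : (in_tuple s)`_i \in s by apply: mem_nth.
by case/allpairsP => -[y z] [_ _ ->].
Qed.

Definition ad_nilpotent (x : g) := forall v, exists k, iter k (lie x) v = 0.

Definition lie_subalgebra (M : {vspace g}) :=
  forall x y, x \in M -> y \in M -> lie x y \in M.

Definition lie_stable (M V : {vspace g}) :=
  forall x y, x \in M -> y \in V -> lie x y \in V.

(** Engel's theorem for M acting on B / A.  Working with pairs of subspaces of g
    lets the induction on [\dim M] apply also to the quotient of M by a
    subalgebra N: the vector found there is an x normalizing N.  Enlarging N by
    such x until it is all of M makes N an ideal of codimension 1; then x acts on
    the vectors that N kills, and being nilpotent it kills one of them. *)
Lemma engel_common_vector (M A B : {vspace g}) : (forall x, ad_nilpotent x) ->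
  lie_subalgebra M -> lie_stable M A -> lie_stable M B -> ~~ (B <= A)%VS ->
  exists v, [/\ v \in B, v \notin A & forall x, x \in M -> lie x v \in A].
Proof.
move=> nil; have [d] := ubnP (\dim M); elim: d => // d IH in M A B *.
rewrite ltnS => Md Msub MA MB BA.
pose codim1_ideal := exists x, x \in M /\ exists N : {vspace g},
  [/\ lie_subalgebra N, (N <= M)%VS, x \notin N,
      (forall y, y \in N -> lie y x \in N) & (M <= N + <[x]>)%VS].
have [M0|[x [xM [N [Nsub NM xN Nx MN]]]]] : M = 0%VS \/ codim1_ideal.
- have [->|M0] := eqVneq M 0%VS; [by left | right].
  suff grow k (N : {vspace g}) : (\dim M - \dim N <= k)%N -> lie_subalgebra N ->
      (N <= M)%VS -> ~~ (M <= N)%VS -> codim1_ideal.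
    apply: (grow _ 0%VS (leqnn _)); rewrite ?sub0v ?subv0//.
    by move=> x y; rewrite !memv0 => /eqP-> _; rewrite lie_0l.
  elim: k N => [|k IHk] N kN Nsub NM MN.
    case/negP: MN; rewrite (_ : N = M)//; apply/eqP.
    by rewrite eqEdim NM -subn_eq0 -leqn0.
  have [x [xM xN Nx]] : exists v,
      [/\ v \in M, v \notin N & forall x, x \in N -> lie x v \in N].
    apply: IH => // [|x y xN yM]; last by apply: Msub => //; apply: (subvP NM).
    rewrite (leq_trans _ Md)// ltn_neqAle dimvS// andbT.
    apply: contra MN => /eqP E; rewrite (_ : N = M)//.
    by apply/eqP; rewrite eqEdim NM E /=.
  have [MNx|MNx] := boolP (M <= N + <[x]>)%VS; first by exists x; split=> //; exists N.
  apply: (IHk (N + <[x]>)%VS) => //.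
  - have /leq_trans : (\dim M - \dim (N + <[x]>) < \dim M - \dim N)%N.
      have lt : (\dim N < \dim (N + <[x]>))%N.
        rewrite ltn_neqAle dimvS ?addvSl// andbT; apply: contra xN => /eqP E.
        rewrite (_ : N = N + <[x]>)%VS ?(subvP (addvSr _ _)) ?memv_line//.
        by apply/eqP; rewrite eqEdim addvSl E /=.
      rewrite ltn_sub2l// (leq_trans lt)// dimvS// subv_add NM /=.
      by rewrite -memvE.
    by move=> /(_ _ kN); rewrite ltnS.
  - move=> _ _ /memv_addP[n1 n1N [_ /vlineP[a1 ->] ->]]
      /memv_addP[n2 n2N [_ /vlineP[a2 ->] ->]].
    apply: (subvP (addvSl N <[x]>)).
    rewrite lie_addl !lie_addr !lie_scaler !lie_scalel liexx !scaler0 addr0.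
    rewrite (lieC x n2) !memvD ?memvZ ?memvN//; first exact: Nsub.
    - exact: Nx.
    - exact: Nx.
  - by rewrite subv_add NM -memvE.
- case/subvPn: BA => v vB vA; exists v; split=> // x.
  by rewrite M0 memv0 => /eqP ->; rewrite lie_0l mem0v.
have Nd : (\dim N < d)%N.
  rewrite (leq_trans _ Md)// ltn_neqAle dimvS// andbT.
  apply/eqP => E; move: xN; rewrite (_ : N = M) ?xM//.
  by apply/eqP; rewrite eqEdim NM E /=.
pose good v := [/\ v \in B, v \notin A & forall x, x \in N -> lie x v \in A].
have [v [vB vA Nv]] : exists v, good v.
  by apply: IH => // [y z /(subvP NM) yM|y z /(subvP NM) yM]; [apply: MA|apply: MB].
have step w : good w -> lie x w \notin A -> good (lie x w).
  case=> wB wA Nw xwA; split=> // [|y yN]; first exact: MB.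
  have -> : lie y (lie x w) = lie (lie y x) w + lie x (lie y w).
    by rewrite lie_lie addrNK.
  by rewrite memvD ?Nw ?Nx// MA// Nw.
have [w [wB wA Nw] xw] : exists2 w, good w & lie x w \in A.
  have [k] := nil x v; have : good v by []; clear vB vA Nv; elim: k => [|k IHk] in v *.
    by move=> [_ + _] /= v0; rewrite v0 mem0v.
  move=> gv; rewrite iterSr => /IHk IHv; case: (boolP (lie x v \in A)) => [xv|/step xv].
    by exists v.
  by apply: IHv; apply: xv.
exists w; split=> // y /(subvP MN) /memv_addP[n nN [_ /vlineP[a ->] ->]].
by rewrite lie_addl lie_scalel memvD ?Nw// memvZ.
Qed.

End SimpleAlgebra.

(** * The Killing form of a simple complex Lie algebra is not zero *)

Section KillingNonzero.
Variables (C : numClosedFieldType) (g : finLieAlgType C).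
Hypothesis g_simple : lie_simple g.

Let e := vbasis {:g}.
Let e_basis : basis_of {:g} e := vbasisP _.
Let A (x : g) := mxof e e (ad x).
Let b u v : 'rV_(\dim {:g}) := rVof e (lie (vecof e u) (vecof e v)).

Let mul_ad u x : u *m A x = rVof e (lie x (vecof e u)).
Proof. by rewrite mul_mxof adE. Qed.

Let b_linr u : linear (b u).
Proof. by move=> a v w; rewrite /b linearP /= lie_addr lie_scaler linearP. Qed.

Let b_linl v : linear (b^~ v).
Proof. by move=> a u w; rewrite /b linearP /= lie_addl lie_scalel linearP. Qed.

Let ad_derivation x : mx_derivation b (A x).
Proof.
move=> u v; rewrite !mul_ad /b !rVofK// -linearD /=; congr (rVof e _).
by rewrite lie_lie addrNK.
Qed.

(** For x = [y, z], the trace of ad x D is that of ad y [ad z, D], up to sign,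
    and [ad z, D] is again some ad z' because D is a derivation. *)
Lemma trace_ad_derivation D : (forall x y : g, killing x y = 0) ->
  mx_derivation b D -> forall x, \tr (A x *m D) = 0.
Proof.
move=> kill0 Dder; elim/(lie_simple_ind g_simple) => [a x y IH IH'||y z].
- rewrite /A ad_linear linearP /= mulmxDl -scalemxAl linearD /= linearZ /=.
  by rewrite -/(A x) -/(A y) IH IH' mulr0 addr0.
- by rewrite /A linear0 linear0 mul0mx linear0.
have -> : A (lie y z) = A z *m A y - A y *m A z.
  by rewrite /A ad_lie linearB /= !(mxof_comp _ _ e_basis).
pose z' := vecof e (rVof e z *m D).
have Az' : A z' = A z *m D - D *m A z.
  apply/row_matrixP => i; rewrite !rowE; set w := delta_mx 0 i.
  rewrite mulmxBr !mulmxA !mul_ad.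
  have := Dder (rVof e z) w; rewrite /b !rVofK// -/z' => ->.
  by rewrite addrK.
rewrite mulmxBl linearB /= -!mulmxA mxtrace_mulC -!mulmxA -linearB /= -mulmxBr.
have -> : D *m A z - A z *m D = - A z' by rewrite Az' opprB.
by rewrite mulmxN linearN /= -killingE kill0 oppr0.
Qed.

Lemma killing_eq0_nilpotent : (forall x y : g, killing x y = 0) ->
  forall x : g, ad_nilpotent x.
Proof.
move=> kill0 x v; exists (\dim {:g}).
have [D [Dder nil]] := conj_derivation b_linl b_linr (ad_derivation x).
have {}nil := nil (trace_ad_derivation kill0 Dder x).
apply/eqP; rewrite -(rVof_eq0 e_basis); apply/eqP; rewrite -[RHS](nil (rVof e v)).
have iter_ad k : rVof e (iter k (lie x) v) = iter k (fun w => w *m A x) (rVof e v).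
  by elim: k => // k IH; rewrite !iterS -IH mul_ad rVofK.
by rewrite iter_ad.
Qed.

Lemma killing_neq0 : exists x y : g, killing x y != 0.
Proof.
apply: contrapT => kill0.
have nil : forall x : g, ad_nilpotent x.
  apply: killing_eq0_nilpotent => x y; apply/eqP; apply: contrapT => /negP xy.
  by apply: kill0; exists x, y.
have [[u [v uv]] _] := g_simple.
have [||||w [_ w0 wC]] := @engel_common_vector _ g fullv 0%VS fullv nil.
- by move=> x y _ _; apply: memvf.
- by move=> x y _; rewrite memv0 => /eqP->; rewrite lie_0r mem0v.
- by move=> x y _ _; apply: memvf.
- apply/negP; rewrite subv0 => /eqP g0; case: uv.
  by apply/eqP; rewrite -memv0 -g0 memvf.
case/negP: w0; rewrite memv0; apply/eqP; apply: (lie_simple_center g_simple) => x.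
by apply/eqP; rewrite -memv0; apply: wC; rewrite memvf.
Qed.
End KillingNonzero.

(** * Coefficients and weights in the affine-Virasoro algebra *)

Section Components.
Variables (K : numFieldType) (g : finLieAlgType K).
Implicit Types (u v w : affvir g) (x y : g) (k m n : int) (a : K).

Definition loop_coef k u : g := (loop_part u)@_k.
Definition witt_coef k u : K := (witt_part u)@_k.

Lemma loop_coef_linear k a u v : loop_coef k (a *: u + v) =
  a *: loop_coef k u + loop_coef k v.
Proof. exact: loop_partP. Qed.

Lemma witt_coef_linear k a u v : witt_coef k (a *: u + v) =
  a * witt_coef k u + witt_coef k v.
Proof. exact: witt_partP. Qed.

HB.instance Definition _ k := GRing.isLinear.Build K (affvir g) g *:%R (loop_coef k)
  (loop_coef_linear k).
HB.instance Definition _ k := GRing.isLinear.Build K (affvir g) K *%R (witt_coef k)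
  (witt_coef_linear k).

Lemma loop_coef_loop k x m : loop_coef k (av_loop x m) = x *+ (m == k).
Proof. by rewrite /loop_coef /= mcoeffU. Qed.
Lemma loop_coef_d k m : loop_coef k (av_d g m) = 0.
Proof. by rewrite /loop_coef /= mcoeff0. Qed.
Lemma loop_coef_K1 k : loop_coef k (av_K1 g) = 0.
Proof. by rewrite /loop_coef /= mcoeff0. Qed.
Lemma loop_coef_K2 k : loop_coef k (av_K2 g) = 0.
Proof. by rewrite /loop_coef /= mcoeff0. Qed.
Lemma witt_coef_loop k x m : witt_coef k (av_loop x m) = 0.
Proof. by rewrite /witt_coef /= mcoeff0. Qed.
Lemma witt_coef_d k m : witt_coef k (av_d g m) = (m == k)%:R.
Proof. by rewrite /witt_coef /= mcoeffU. Qed.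
Lemma witt_coef_K1 k : witt_coef k (av_K1 g) = 0.
Proof. by rewrite /witt_coef /= mcoeff0. Qed.
Lemma witt_coef_K2 k : witt_coef k (av_K2 g) = 0.
Proof. by rewrite /witt_coef /= mcoeff0. Qed.

Definition compE := (loop_coef_loop, loop_coef_d, loop_coef_K1, loop_coef_K2,
  witt_coef_loop, witt_coef_d, witt_coef_K1, witt_coef_K2).

Lemma lie_K1r u : lie u (av_K1 g) = 0. Proof. exact: av_K1_central. Qed.
Lemma lie_K2r u : lie u (av_K2 g) = 0. Proof. exact: av_K2_central. Qed.

Lemma lie_loop_d x m n : lie (av_loop x m) (av_d g n) = - (m%:~R *: av_loop x (n + m)).
Proof. by rewrite lieC lie_affvirE av_d_loop. Qed.

Lemma loop_coef_lie_d k m u : loop_coef k (lie (av_d g m) u) =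
  (k - m)%:~R *: loop_coef (k - m) u.
Proof.
elim/affvir_ind: u => [a u v IH IH'||x n|n||]; last 2 first.
- by rewrite lie_K1r linear0 loop_coef_K1 scaler0.
- by rewrite lie_K2r linear0 loop_coef_K2 scaler0.
- by rewrite lie_addr lie_scaler !loop_coef_linear IH IH' scalerDr !scalerA mulrC.
- by rewrite lie_0r !linear0.
- rewrite lie_affvirE av_d_loop linearZ /= !compE.
  have -> : (n == k - m) = (m + n == k) by rewrite eq_sym subr_eq eq_sym addrC.
  by case: eqP => [<-|]; rewrite ?scaler0// [m + n]addrC addrK.
- by rewrite lie_affvirE av_d_d linearD !linearZ /= !compE !scaler0 addr0.
Qed.

Lemma witt_coef_lie_d k m u : witt_coef k (lie (av_d g m) u) =
  (k - m *+ 2)%:~R * witt_coef (k - m) u.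
Proof.
elim/affvir_ind: u => [a u v IH IH'||x n|n||]; last 2 first.
- by rewrite lie_K1r linear0 witt_coef_K1 mulr0.
- by rewrite lie_K2r linear0 witt_coef_K2 mulr0.
- by rewrite lie_addr lie_scaler !witt_coef_linear IH IH' mulrDr mulrCA.
- by rewrite lie_0r !linear0 mulr0.
- by rewrite lie_affvirE av_d_loop linearZ /= !compE !mulr0.
- rewrite lie_affvirE av_d_d linearD !linearZ /= !compE mulr0 addr0.
  have -> : (n == k - m) = (m + n == k) by rewrite eq_sym subr_eq eq_sym addrC.
  by case: eqP => [<-|]; rewrite ?mulr0// !mulr1; congr (_%:~R); ring.
Qed.

Lemma loop_coef_lie_loop k x m u :
  loop_coef k (lie (av_loop x m) u) =
  lie x (loop_coef (k - m) u) - (m%:~R * witt_coef (k - m) u) *: x.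
Proof.
elim/affvir_ind: u => [a u v IH IH'||y n|n||]; last 2 first.
- by rewrite lie_K1r linear0 loop_coef_K1 witt_coef_K1 lie_0r mulr0 scale0r subr0.
- by rewrite lie_K2r linear0 loop_coef_K2 witt_coef_K2 lie_0r mulr0 scale0r subr0.
- rewrite lie_addr lie_scaler !loop_coef_linear IH IH' witt_coef_linear lie_addr lie_scaler.
  by rewrite mulrDr scalerDl opprD mulrCA scalerBr [a *: (_ *: x)]scalerA [RHS]addrACA.
- by rewrite lie_0r !linear0 mulr0 scale0r subr0.
- rewrite lie_affvirE av_loop_loop linearD linearZ /= !compE mulr0 scaler0 scale0r.
  have -> : (n == k - m) = (m + n == k) by rewrite eq_sym subr_eq eq_sym addrC.
  by rewrite addr0 subr0; case: eqP; rewrite ?mulr0n ?lie_0r.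
- rewrite lie_loop_d linearN linearZ /= !compE lie_0r sub0r.
  have -> : (n == k - m) = (n + m == k) by rewrite eq_sym subr_eq eq_sym.
  by case: eqP; rewrite ?mulr1 ?mulr0 ?scale0r ?scaler0.
Qed.

Lemma witt_coef_lie_loop k x m u : witt_coef k (lie (av_loop x m) u) = 0.
Proof.
elim/affvir_ind: u => [a u v IH IH'||y n|n||]; last 2 first.
- by rewrite lie_K1r linear0.
- by rewrite lie_K2r linear0.
- by rewrite lie_addr lie_scaler !witt_coef_linear IH IH' mulr0 addr0.
- by rewrite lie_0r !linear0.
- by rewrite lie_affvirE av_loop_loop linearD linearZ /= !compE mulr0 addr0.
- by rewrite lie_loop_d linearN linearZ /= !compE mulr0 oppr0.
Qed.

Definition affvir_central u := loop_part u = 0 /\ witt_part u = 0.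

Lemma affvir_centralP u :
  (forall k, loop_coef k u = 0) -> (forall k, witt_coef k u = 0) -> affvir_central u.
Proof.
by move=> ul uw; split; apply/malgP => k; rewrite mcoeff0; [apply: ul|apply: uw].
Qed.

Lemma affvir_central_lin a u v : affvir_central u -> affvir_central v ->
  affvir_central (a *: u + v).
Proof.
move=> [u1 u2] [v1 v2].
apply: affvir_centralP => k.
  by rewrite loop_coef_linear /loop_coef u1 v1 !mcoeff0 scaler0 addr0.
by rewrite witt_coef_linear /witt_coef u2 v2 !mcoeff0 mulr0 addr0.
Qed.

Lemma lie_affvir_central u v : affvir_central u -> lie v u = 0.
Proof.
move=> [ul uw]; have -> : u = K1_part u *: av_K1 g + K2_part u *: av_K2 g.
  apply: affvirP => /=; rewrite ?scaler0 ?addr0 ?ul ?uw ?mulr0 ?mulr1 ?add0r ?addr0//.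
by rewrite lie_addr !lie_scaler lie_K1r lie_K2r !scaler0 addr0.
Qed.

Definition weight n u := lie (av_d g 0) u = n%:~R *: u.

Lemma weight_d n : weight n (av_d g n).
Proof.
rewrite /weight lie_affvirE av_d_d add0r subr0 expr0n subrr mul0r mul0rn.
by rewrite scale0r addr0.
Qed.

Lemma weight_loop x n : weight n (av_loop x n).
Proof. by rewrite /weight lie_affvirE av_d_loop add0r. Qed.

Lemma weight_K1 : weight 0 (av_K1 g).
Proof. by rewrite /weight lie_K1r scale0r. Qed.

Lemma weight_K2 : weight 0 (av_K2 g).
Proof. by rewrite /weight lie_K2r scale0r. Qed.

Lemma weightP n a u v : weight n u -> weight n v -> weight n (a *: u + v).
Proof.
by move=> nu nv; rewrite /weight lie_addr lie_scaler nu nv scalerDr !scalerA mulrC.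
Qed.

Lemma weight_lie m n u v : weight m u -> weight n v -> weight (m + n) (lie u v).
Proof.
move=> mu nv; rewrite /weight lie_leibniz mu nv lie_scalel lie_scaler -scalerDl.
by rewrite intrD.
Qed.

Lemma weight_loop_coef n u k : weight n u -> k != n -> loop_coef k u = 0.
Proof.
move=> /(congr1 (loop_coef k)); rewrite loop_coef_lie_d subr0 linearZ /= => /eqP.
rewrite -subr_eq0 -scalerBl -intrB scaler_eq0 intr_eq0 subr_eq0.
by case: eqP => //= _ /eqP.
Qed.

Lemma weight_witt_coef n u k : weight n u -> k != n -> witt_coef k u = 0.
Proof.
move=> /(congr1 (witt_coef k)); rewrite witt_coef_lie_d mul0rn !subr0 linearZ /= => /eqP.
rewrite -subr_eq0 -mulrBl -intrB mulf_eq0 intr_eq0 subr_eq0.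
by case: eqP => //= _ /eqP.
Qed.

Lemma weight_affvir_central n u :
  weight n u -> loop_coef n u = 0 -> witt_coef n u = 0 ->
  affvir_central u.
Proof.
move=> nu ul uw; apply: affvir_centralP => k; have [->//|kn] := eqVneq k n.
  exact: weight_loop_coef nu kn.
exact: weight_witt_coef nu kn.
Qed.

End Components.

(** * Perfectness of the affine-Virasoro algebra *)

Section Perfect.
Variables (K : numFieldType) (g : finLieAlgType K).
Hypothesis g_simple : lie_simple g.
Hypothesis killing_nz : exists x y : g, killing x y != 0.
Local Notation X := (@av_loop K g).
Local Notation d := (@av_d K g).

(** Brackets of vectors of nonzero weight span the whole algebra.  In weight
    m != 0 they are taken in weights - m and 2 m.  In weight 0, comparing the
    weights (1, -1) with (2, -2) separates d_0 from K_2, and separates the loop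
    part from K_1: this is where the Killing form must not vanish. *)
Lemma affvir_lie_ind (P : affvir g -> Prop) :
    (forall a u v, P u -> P v -> P (a *: u + v)) -> P 0 ->
    (forall i j u v, i != 0 -> j != 0 -> weight i u -> weight j v -> P (lie u v)) ->
  forall u, P u.
Proof.
move=> PD P0 Plie.
have PZ a u : P u -> P (a *: u) by move=> Pu; rewrite -[_ *: u]addr0; apply: PD.
have PZV a u : a != 0 -> P (a *: u) -> P u.
  by move=> a0 /(PZ a^-1); rewrite scalerA mulVf// scale1r.
have PB u v : P u -> P v -> P (u - v).
  by move=> Pu Pv; rewrite addrC -scaleN1r; apply: PD.
have PXX x m y n : m != 0 -> n != 0 -> P (lie (X x m) (X y n)).
  by move=> m0 n0; apply: (Plie m n) => //; apply: weight_loop.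
have Pdd m n : m != 0 -> n != 0 -> P (lie (d m) (d n)).
  by move=> m0 n0; apply: (Plie m n) => //; apply: weight_d.
have PK1 : P (av_K1 g).
  have [x [y xy]] := killing_nz; apply: (PZV (killing x y)) => //.
  have -> : killing x y *: av_K1 g = lie (X x 2) (X y (-2)) - lie (X x 1) (X y (-1)).
    rewrite !lie_affvirE !av_loop_loop !subrr !mulr1n opprD addrACA.
    rewrite subrr add0r -scalerBl.
    by congr (_ *: _); ring.
  by apply: PB; apply: PXX.
have Pd0 : P (d 0).
  apply: (PZV (-2)); first by rewrite oppr_eq0 pnatr_eq0.
  have -> : -2 *: d 0 = lie (d 1) (d (-1)).
    by rewrite lie_affvirE av_d_d [_ ^+ 3 - _](_ : _ = 0)// mul0r mul0rn scale0r addr0.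
  exact: Pdd.
have PK2 : P (av_K2 g).
  apply: (PZV (1 / 2)); first by rewrite mul1r invr_eq0 pnatr_eq0.
  have -> : (1 / 2) *: av_K2 g = lie (d 2) (d (-2)) - (-4) *: d 0.
    rewrite lie_affvirE av_d_d subrr mulr1n addrAC -scalerBl.
    rewrite (_ : (-2 - 2)%:~R - -4 = 0 :> K); last by ring.
    rewrite scale0r add0r; congr (_ *: _); by field.
  by apply: PB; [apply: Pdd|apply: PZ].
elim/affvir_ind => [//|//|x m|m|//|//].
- elim/(lie_simple_ind g_simple): x => [a x y Px Py||x y].
  + have -> : X (a *: x + y) m = a *: X x m + X y m.
      by apply: affvirP => /=; rewrite ?scaler0 ?mulr0 ?addr0// monalgUD laurentZU.
    exact: PD.
  + by have -> : X 0 m = 0; [apply: affvirP => //=; rewrite monalgU0|].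
  + have [->|m0] := eqVneq m 0.
      have -> : X (lie x y) 0 = lie (X x 1) (X y (-1)) - killing x y *: av_K1 g.
        by rewrite lie_affvirE av_loop_loop subrr mulr1n mul1r addrK.
      by apply: PB; [apply: PXX|apply: PZ].
    have -> : X (lie x y) m = lie (X x (- m)) (X y (m *+ 2)).
      rewrite lie_affvirE av_loop_loop (_ : - m + m *+ 2 = m); last by ring.
      by rewrite (negbTE m0) mulr0n scale0r addr0.
    by apply: PXX; rewrite ?oppr_eq0// mulrn_eq0.
- have [->//|m0] := eqVneq m 0.
  apply: (PZV (m *+ 3)%:~R); first by rewrite intr_eq0 mulrn_eq0.
  have -> : (m *+ 3)%:~R *: d m = lie (d (- m)) (d (m *+ 2)).
    rewrite lie_affvirE av_d_d (_ : - m + m *+ 2 = m); last by ring.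
    rewrite (negbTE m0) mulr0n scale0r addr0; congr (_%:~R *: _); ring.
  by apply: Pdd; rewrite ?oppr_eq0// mulrn_eq0.
Qed.

End Perfect.

(** * Biderivations *)

Section BiderivationSpace.
Variables (K : comNzRingType) (L : lieAlgType K).

Lemma biderivation_sub_inner (F : L -> L -> L) (a : K) :
  biderivation F -> biderivation (fun x y => F x y - a *: lie x y).
Proof.
have sub4 (p q r s : L) : p - q - a *: (r - s) = p - a *: r - (q - a *: s).
  rewrite scalerBr !opprB -!addrA; congr (_ + _).
  by rewrite addrCA [RHS]addrCA; congr (_ + _); apply: addrC.
case=> [[Fbl Fbr] Fl Fr]; split.
- split=> [z c x y|z c x y].
    by rewrite /= Fbl lie_addl lie_scalel scalerDr opprD scalerBr addrACA !scalerA mulrC.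
  by rewrite /= Fbr lie_addr lie_scaler scalerDr opprD scalerBr addrACA !scalerA mulrC.
- move=> x y z; rewrite Fl !lie_addr !lie_oppr !lie_scaler -sub4.
  by rewrite (lie_leibniz x y z) addrK.
- move=> x y z; rewrite Fr !lie_addr !lie_oppr !lie_scaler -sub4.
  by congr (_ - _ *: _); rewrite (lie_leibniz x y z) addrC (lieC (lie x y)).
Qed.
End BiderivationSpace.

Section Biderivation.
Variables (K : numFieldType) (g : finLieAlgType K).
Hypothesis g_simple : lie_simple g.
Hypothesis killing_nz : exists x y : g, killing x y != 0.
Local Notation X := (@av_loop K g).
Local Notation d := (@av_d K g).
Implicit Types (F : affvir g -> affvir g -> affvir g) (u v w : affvir g).
Implicit Types (m n k : int) (x y : g).

Section D0.
Variable F : affvir g -> affvir g -> affvir g.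
Hypothesis F_bider : biderivation F.

Let F_deriv u v w : F u (lie v w) = lie v (F u w) - lie w (F u v).
Proof. by case: F_bider. Qed.
Let F_derivl u v w : F (lie u v) w = lie u (F v w) - lie v (F u w).
Proof. by case: F_bider. Qed.
Let F_linr u a v w : F u (a *: v + w) = a *: F u v + F u w.
Proof. by case: F_bider => [[_ ->]]. Qed.
Let F_linl u a v w : F (a *: v + w) u = a *: F v u + F w u.
Proof. by case: F_bider => [[-> _]]. Qed.
Let F0r u : F u 0 = 0.
Proof. by have := F_linr u (-1) 0 0; rewrite scaler0 addr0 scaleN1r addNr. Qed.
Let F0l u : F 0 u = 0.
Proof. by have := F_linl u (-1) 0 0; rewrite scaler0 addr0 scaleN1r addNr. Qed.
Let FZr u a v : F u (a *: v) = a *: F u v.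
Proof. by rewrite -[_ *: v]addr0 F_linr F0r addr0. Qed.
Let FZl u a v : F (a *: v) u = a *: F v u.
Proof. by rewrite -[_ *: v]addr0 F_linl F0l addr0. Qed.

(** The derivation rule for [d_0, u]: the failure of F(u, v) to have weight n is
    measured by F(d_0, v). *)
Lemma bider_weightl n u v : weight n u ->
  lie (d 0) (F u v) - n%:~R *: F u v = lie u (F (d 0) v).
Proof. by move=> nu; rewrite -FZl -nu F_derivl opprB addrC subrK. Qed.

Lemma bider_weightr m u v : weight m v ->
  lie (d 0) (F u v) - m%:~R *: F u v = lie v (F u (d 0)).
Proof. by move=> mv; rewrite -FZr -mv F_deriv opprB addrC subrK. Qed.

Lemma loop_coef_weight_defect k n w :
  loop_coef k (lie (d 0) w - n%:~R *: w) = (k - n)%:~R *: loop_coef k w.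
Proof. by rewrite linearB linearZ /= loop_coef_lie_d subr0 -scalerBl intrB. Qed.

Lemma witt_coef_weight_defect k n w :
  witt_coef k (lie (d 0) w - n%:~R *: w) = (k - n)%:~R * witt_coef k w.
Proof. by rewrite linearB linearZ /= witt_coef_lie_d mul0rn subr0 -mulrBl intrB. Qed.

(** In weight 0, x t^0 acts on the coefficient of F(d_0, v) as ad x, while the
    weight defect is 0; hence the coefficient is in the centre of g. *)
Lemma loop_coef_d0_0 v : loop_coef 0 (F (d 0) v) = 0.
Proof.
apply: (lie_simple_center g_simple) => x.
have := congr1 (loop_coef 0) (bider_weightl v (weight_loop x 0)).
by rewrite loop_coef_weight_defect loop_coef_lie_loop subrr scale0r mul0r scale0r subr0.
Qed.

Lemma witt_coef_d0_0 v : witt_coef 0 (F (d 0) v) = 0.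
Proof.
have := congr1 (witt_coef 1) (bider_weightl v (weight_d g 1)).
rewrite witt_coef_weight_defect witt_coef_lie_d subrr mul0r => /esym/eqP.
by rewrite mulf_eq0 intr_eq0 => /orP[//|/eqP].
Qed.

(** Bracketing F(d_0, d_0) with d_m moves its weight - m part to weight 0, with
    a nonzero factor if m != 0; there it vanishes by the two lemmas above. *)
Lemma d0_d0_central : affvir_central (F (d 0) (d 0)).
Proof.
have E m : lie (d m) (F (d 0) (d 0))
    = lie (d 0) (F (d 0) (d m)) - m%:~R *: F (d 0) (d m).
  by rewrite (bider_weightr _ (weight_d g m)).
apply: affvir_centralP => k.
  have [->|k0] := eqVneq k 0; first exact: loop_coef_d0_0.
  have := congr1 (loop_coef 0) (E (- k)).
  rewrite loop_coef_weight_defect loop_coef_d0_0 scaler0 loop_coef_lie_d opprK add0r => /eqP.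
  by rewrite scaler_eq0 intr_eq0 (negbTE k0) => /eqP.
have [->|k0] := eqVneq k 0; first exact: witt_coef_d0_0.
have := congr1 (witt_coef 0) (E (- k)).
rewrite witt_coef_weight_defect witt_coef_d0_0 mulr0 witt_coef_lie_d opprK !add0r => /eqP.
by rewrite mulf_eq0 intr_eq0 mulNrn opprK mulrn_eq0 (negbTE k0) => /eqP.
Qed.

Lemma weight_d0 m v : weight m v -> weight m (F (d 0) v).
Proof.
move=> mv; apply/eqP; rewrite -subr_eq0 (bider_weightr _ mv).
by rewrite lie_affvir_central//; apply: d0_d0_central.
Qed.

(** In weight n + m, both weight defects are multiples of the same coefficient of
    F(u, v), by m and by n. *)
Lemma loop_coef_d0_exchange m n u v : weight n u -> weight m v ->
  n%:~R *: loop_coef (n + m) (lie u (F (d 0) v))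
  = m%:~R *: loop_coef (n + m) (lie v (F u (d 0))).
Proof.
move=> nu mv; rewrite -(bider_weightl _ nu) -(bider_weightr _ mv).
by rewrite !loop_coef_weight_defect addrK addrC addKr !scalerA mulrC.
Qed.

Lemma witt_coef_d0_exchange m n u v : weight n u -> weight m v ->
  n%:~R * witt_coef (n + m) (lie u (F (d 0) v))
  = m%:~R * witt_coef (n + m) (lie v (F u (d 0))).
Proof.
move=> nu mv; rewrite -(bider_weightl _ nu) -(bider_weightr _ mv).
by rewrite !witt_coef_weight_defect addrK addrC addKr mulrCA.
Qed.

(** Perfectness gives F(d_0, .) = 0, so F(u, .) has the weight of u; the rule for
    [v, w] puts F(u, [v, w]) in other weights when v and w have nonzero weight.
    So F is central-valued, and perfectness applies again. *)
Lemma bider_d0_eq0 : (forall v, affvir_central (F (d 0) v)) -> forall u v, F u v = 0.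
Proof.
move=> d0C.
have d00 v : F (d 0) v = 0.
  elim/(affvir_lie_ind g_simple killing_nz): v => [a u v IH IH'|//|i j u v _ _ _ _].
    by rewrite F_linr IH IH' scaler0 addr0.
  by rewrite F_deriv !(lie_affvir_central _ (d0C _)) subrr.
have weightF n u v : weight n u -> weight n (F u v).
  by move=> nu; apply/eqP; rewrite -subr_eq0 (bider_weightl _ nu) d00 lie_0r.
have centralF n u v : weight n u -> affvir_central (F u v).
  move=> nu.
  elim/(affvir_lie_ind g_simple killing_nz): v => [a v w IH IH'||i j v w i0 j0 iv jw].
  - by rewrite F_linr; apply: affvir_central_lin.
  - by rewrite F0r.
  have wt1 : weight (i + n) (lie v (F u w)) by apply: weight_lie => //; apply: weightF.
  have wt2 : weight (j + n) (lie w (F u v)) by apply: weight_lie => //; apply: weightF.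
  have neq l : l != 0 -> n != l + n.
    by move=> l0; rewrite -{1}[n]add0r (inj_eq (addIr n)) eq_sym.
  apply: (weight_affvir_central (n := n)); first exact: weightF.
    by rewrite F_deriv linearB /= (weight_loop_coef wt1) ?(weight_loop_coef wt2) ?neq// subrr.
  by rewrite F_deriv linearB /= (weight_witt_coef wt1) ?(weight_witt_coef wt2) ?neq// subrr.
have {}centralF u v : affvir_central (F u v).
  elim/affvir_ind: u => [a u u' IH IH'||x m|m||].
  - by rewrite F_linl; apply: affvir_central_lin.
  - by rewrite F0l.
  - exact/centralF/weight_loop.
  - exact/centralF/weight_d.
  - exact/centralF/weight_K1.
  - exact/centralF/weight_K2.
move=> u v.
elim/(affvir_lie_ind g_simple killing_nz): v => [a v w IH IH'|//|i j v w _ _ _ _].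
  by rewrite F_linr IH IH' scaler0 addr0.
by rewrite F_deriv !(lie_affvir_central _ (centralF _ _)) subrr.
Qed.

End D0.

(** The constant is read off F(d_0, d_1).  The exchange relation links
    F(d_0, d_m) to F(d_n, d_0) for all n != m, hence all these values to one
    another through a third index.  The loop coefficient h of F(d_0, d_1) is
    shared by all F(d_0, d_m) with m != 0, and the loop coefficient of
    F(d_0, x t^m) is [x, h] / n + m c x for every n other than 0 and 1; so
    [x, h] = 0 for all x, and h = 0. *)
Lemma bider_d0_scalar F : biderivation F ->
  exists a, forall v, affvir_central (F (d 0) v - a *: lie (d 0) v).
Proof.
move=> Fb.
pose c := witt_coef 1 (F (d 0) (d 1)); pose h := loop_coef 1 (F (d 0) (d 1)).
have shift (n m : int) : n + m - n = m by rewrite addrC addKr.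
have avoid m : exists n : int, [/\ n != 0, n != 1 & n != m].
  by have [->|m2] := eqVneq m 2; [exists 3|exists 2; split; rewrite // eq_sym].
have wdd n m : n != m ->
    n%:~R * witt_coef m (F (d 0) (d m)) = - (m%:~R * witt_coef n (F (d n) (d 0))).
  move=> nm; have := witt_coef_d0_exchange Fb (weight_d g n) (weight_d g m).
  rewrite !witt_coef_lie_d shift addrK => E; apply/eqP; rewrite -addr_eq0.
  have : (m - n)%:~R != 0 :> K by rewrite intr_eq0 subr_eq0 eq_sym.
  move=> /mulfI /inj_eq <-; apply/eqP; rewrite mulr0.
  by move/eqP: E; rewrite -subr_eq0 => /eqP <-; ring.
have wd' n : n != 1 -> witt_coef n (F (d n) (d 0)) = - (n%:~R * c).
  by move=> /wdd; rewrite -/c mul1r => ->; rewrite opprK.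
have wd m : m != 0 -> witt_coef m (F (d 0) (d m)) = m%:~R * c.
  move=> m0; have [n [n0 n1 nm]] := avoid m.
  apply: (@mulfI _ n%:~R); first by rewrite intr_eq0.
  by rewrite (wdd n m nm) wd'// mulrN opprK mulrCA.
have ldd n m : n != 0 -> m != 0 ->
    loop_coef m (F (d 0) (d m)) = loop_coef n (F (d n) (d 0)).
  move=> n0 m0; have := loop_coef_d0_exchange Fb (weight_d g n) (weight_d g m).
  rewrite !loop_coef_lie_d shift addrK !scalerA (mulrC m%:~R) => /scalerI; apply.
  by rewrite mulf_neq0// intr_eq0.
have wdX m x : m != 0 -> witt_coef m (F (d 0) (X x m)) = 0.
  move=> m0; have [n [n0 _ nm]] := avoid m.
  have := witt_coef_d0_exchange Fb (weight_d g n) (weight_loop x m).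
  rewrite witt_coef_lie_loop witt_coef_lie_d shift mulr0 => /eqP.
  rewrite !mulf_eq0 !intr_eq0 (negbTE n0) /= => /orP[|/eqP//].
  by rewrite mulr2n opprD addrA shift subr_eq0 eq_sym (negbTE nm).
have ldX n m x : n != 0 -> n != 1 -> m != 0 ->
    n%:~R *: loop_coef m (F (d 0) (X x m)) = lie x h + (n%:~R * (m%:~R * c)) *: x.
  move=> n0 n1 m0; apply: (@scalerI _ _ m%:~R); first by rewrite intr_eq0.
  have := loop_coef_d0_exchange Fb (weight_d g n) (weight_loop x m).
  rewrite loop_coef_lie_loop loop_coef_lie_d shift addrK scalerA => E.
  rewrite scalerA (mulrC m%:~R) E.
  by rewrite wd'// -(ldd n 1)// mulrN scaleNr opprK mulrCA.
have h0 : h = 0.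
  apply: (lie_simple_center g_simple) => x.
  have E2 := ldX 2 1 x isT isT isT; have E3 := ldX 3 1 x isT isT isT.
  have : 3%:~R *: (2%:~R *: loop_coef 1 (F (d 0) (X x 1)))
       = 2%:~R *: (3%:~R *: loop_coef 1 (F (d 0) (X x 1))) by rewrite !scalerA mulrC.
  rewrite E2 E3 !scalerDr !scalerA (mulrCA 3%:~R 2%:~R) => /addIr /eqP.
  by rewrite -subr_eq0 -scalerBl -intrB scaler_eq0 => /orP[|/eqP//]; rewrite intr_eq0.
have ldX' m x : m != 0 -> loop_coef m (F (d 0) (X x m)) = (m%:~R * c) *: x.
  move=> m0; apply: (@scalerI _ _ 2%:~R); first by rewrite intr_eq0.
  by rewrite ldX// h0 lie_0r add0r scalerA.
exists c; pose Q v := affvir_central (F (d 0) v - c *: lie (d 0) v).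
have Q_weight m v : weight m v -> m != 0 ->
    loop_coef m (F (d 0) v) = (m%:~R * c) *: loop_coef m v ->
    witt_coef m (F (d 0) v) = m%:~R * c * witt_coef m v -> Q v.
  move=> mv m0 El Ew; apply: (weight_affvir_central (n := m)).
  - rewrite addrC -scaleNr; apply: weightP; last exact: weight_d0.
    by rewrite -[m]add0r; apply: weight_lie => //; apply: weight_d.
  - by rewrite linearB /= El mv scalerA [loop_coef _ (_ *: v)]linearZ /= mulrC subrr.
  - by rewrite linearB /= Ew mv scalerA [witt_coef _ (_ *: v)]linearZ /= (mulrC c) subrr.
have Q0 v : weight 0 v -> Q v.
  move=> v0; rewrite /Q v0 scale0r scaler0 subr0.
  apply: (weight_affvir_central (weight_d0 Fb v0)); first exact: loop_coef_d0_0.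
  exact: witt_coef_d0_0.
elim/affvir_ind => [a u v IH IH'||x m|m||]; rewrite -/(Q _).
- have [[_ G_lin] _ _] := biderivation_sub_inner c Fb.
  have /= E := G_lin (d 0) a u v; rewrite /Q E.
  move: (F (d 0) u - _) (F (d 0) v - _) IH IH' => p q; exact: affvir_central_lin.
- by apply: Q0; rewrite /weight lie_0r scaler0.
- have [->|m0] := eqVneq m 0; first exact/Q0/weight_loop.
  apply: (Q_weight m) => //; first exact: weight_loop.
    by rewrite ldX'// compE eqxx.
  by rewrite wdX// compE mulr0.
- have [->|m0] := eqVneq m 0; first exact/Q0/weight_d.
  apply: (Q_weight m) => //; first exact: weight_d.
    by rewrite (ldd 1 m)// -(ldd 1 1)// -/h h0 compE scaler0.
  by rewrite wd// compE eqxx mulr1.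
- exact/Q0/weight_K1.
- exact/Q0/weight_K2.
Qed.

Theorem affvir_biderivation_inner F : biderivation F -> inner_biderivation F.
Proof.
move=> Fb; have [a aP] := bider_d0_scalar Fb; exists a => u v.
apply/eqP; rewrite -subr_eq0; apply/eqP.
exact: (bider_d0_eq0 (biderivation_sub_inner a Fb) aP).
Qed.
End Biderivation.

Local Open Scope complex_scope.

Theorem corollary3p9 (R : realType) (g : finLieAlgType R[i])
    (g_simple : lie_simple g) (F : affvir g -> affvir g -> affvir g) :
  biderivation F -> inner_biderivation F.
Proof.
exact: (affvir_biderivation_inner g_simple (killing_neq0 g_simple)).
Qed.
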